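(* The Wiener measure of $\mathrm{PLA}\cap C(\mathbb{T})$ is zero.
   Context: $\mathbb{T}=\mathbb{R}/2\pi\mathbb{Z}$ is the circle, and $C(\mathbb{T})$ is the space of continuous functions on $\mathbb{T}$ with the uniform norm. A function $f$ on $\mathbb{T}$ belongs to $\mathrm{PLA}$ (pointwise limits of analytic sums) if there are complex coefficients $c(n)$, $n\ge 0$, such that the series $\sum_{n\geq 0}c(n)e^{int}$ converges to $f(t)$ for almost every $t\in\mathbb{T}$ (with respect to Lebesgue measure). The coefficients $c(n)$ are not required to be the Fourier coefficients of $f$. Wiener measure is the probability measure on continuous functions given by the law of Brownian motion, here regarded as a measure on $C(\mathbb{T})$. *)

(* Defs.v *)
(* MathComp / MathComp-Analysis. *)
From HB Require Import structures.
From mathcomp Require Import all_boot all_order all_algebra.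
From mathcomp Require Import all_classical all_reals all_analysis.
From mathcomp Require Import complex.

Set Implicit Arguments.
Unset Strict Implicit.
Unset Printing Implicit Defensive.

Import Order.TTheory GRing.Theory Num.Theory numFieldNormedType.Exports.
Local Open Scope classical_set_scope.
Local Open Scope ring_scope.
Local Open Scope complex_scope.

(* [R[i]] carries the topology of its modulus, as a normed space over itself;
   [complex] being a head constant of its own, the generic instance for
   number fields is not found by unification and has to be copied. *)
HB.instance Definition _ (R : realType) :=
  NormedModule.copy R[i] (R[i] : numFieldType)^o.

(* C(T), T = R/2piZ: functions on T are 2pi-periodic functions on R. *)
Record circle_fun (R : realType) := CircleFun {
  circle_val :> R -> R[i] ;
  circle_continuous : continuous circle_val ;
  circle_periodic : forall t, circle_val (t + 2 * pi) = circle_val t }.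

HB.instance Definition _ (R : realType) := gen_eqMixin (circle_fun R).
HB.instance Definition _ (R : realType) := gen_choiceMixin (circle_fun R).
HB.instance Definition _ (R : realType) :=
  isPointed.Build (circle_fun R)
    (CircleFun (fun x : R => @cst_continuous R R[i] 0 x) (fun=> erefl)).

(* The uniform norm is used only through the topology it induces, which is
   that of uniform convergence. *)
HB.instance Definition _ (R : realType) :=
  Uniform.copy (circle_fun R)
    (initial_topology (@circle_val R : circle_fun R -> {uniform R -> R[i]})).

Definition circle_fun_borel (R : realType) :=
  g_sigma_algebraType (@open (circle_fun R)).

Definition expi (R : realType) (t : R) : R[i] := cos t +i* sin t.

Definition PLA (R : realType) : set (R -> R[i]) :=
  [set f | exists c : nat -> R[i],
     {ae (@lebesgue_measure R), forall t, t \in `[0, 2 * pi[ ->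
        series (fun n => c n * expi (n%:R * t)) @ \oo --> f t}].

Section brownian.
Context (d : measure_display) (Omega : measurableType d) (R : realType).
Variable P : probability Omega R.

(* The second argument of [normal_prob] is the standard deviation. *)
Record brownian_motion (B : R -> Omega -> R) : Prop := BrownianMotion {
  brownian_measurable : forall t : R, 0 <= t -> measurable_fun setT (B t) ;
  brownian_start : forall w, B 0 w = 0 ;
  brownian_continuous :
    forall w, {within `[0, +oo[, continuous (fun t => B t w)} ;
  brownian_increment : forall s t : R, 0 <= s -> s < t ->
    forall A : set R, measurable A ->
      P ((B t \- B s) @^-1` A) = normal_prob 0 (Num.sqrt (t - s)) A ;
  brownian_independent : forall (n : nat) (t : nat -> R), 0 <= t 0%N ->
    (forall i, (i < n)%N -> t i < t i.+1) ->
    forall A : nat -> set R, (forall i, measurable (A i)) ->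
      P (\bigcap_(i < n) ((B (t i.+1) \- B (t i)) @^-1` A i)) =
      (\prod_(i < n) P ((B (t i.+1) \- B (t i))%R @^-1` A i))%E }.

Record complex_brownian_motion (Z : R -> Omega -> R[i]) : Prop :=
  ComplexBrownianMotion {
  complex_brownian_Re : brownian_motion (fun t w => complex.Re (Z t w)) ;
  complex_brownian_Im : brownian_motion (fun t w => complex.Im (Z t w)) ;
  complex_brownian_independent : forall (n : nat) (t : nat -> R),
    (forall i, 0 <= t i) ->
    forall A A' : nat -> set R,
    (forall i, measurable (A i)) -> (forall i, measurable (A' i)) ->
    let E := \bigcap_(i < n) [set w | A i (complex.Re (Z (t i) w))] in
    let E' := \bigcap_(i < n) [set w | A' i (complex.Im (Z (t i) w))] in
    P (E `&` E') = (P E * P E')%E }.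

(* X is the path of Z on [0, 2pi], tied down at 2pi by subtracting the linear
   term (t / 2pi) Z(2pi) so that it closes up into a loop: for Z a Brownian
   motion this is the Brownian bridge, i.e. Brownian motion conditioned to
   return to 0 at time 2pi. *)
Definition loop_of (Z : R -> Omega -> R[i]) (X : Omega -> circle_fun R) :=
  forall w (t : R), 0 <= t <= 2 * pi ->
    X w t = Z t w - (t / (2 * pi))%:C * Z (2 * pi) w.

End brownian.

(* Wiener measure on C(T): the law of Brownian motion, closed up into a loop
   since almost no Brownian path is 2pi-periodic.  As C(T) consists of
   complex-valued functions, both the law of the real Brownian motion (carried
   by the real-valued functions) and that of the complex one are admitted. *)
Definition wiener_measure (R : realType)
    (W : probability (circle_fun_borel R) R) : Prop :=
  exists (d : measure_display) (Omega : measurableType d)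
         (P : probability Omega R) (Z : R -> Omega -> R[i])
         (X : Omega -> circle_fun_borel R),
    [/\ (exists2 B, brownian_motion P B & Z = fun t w => (B t w)%:C)
          \/ complex_brownian_motion P Z,
        loop_of Z X,
        measurable_fun setT X &
        forall A, measurable A -> W A = P (X @^-1` A)].

(* Main.v *)
(* If the sums of two analytic series differ by a linear function on most of the
   circle, the slope of that function is zero: the difference of the two series,
   shifted by a small angle and subtracted from itself, is an analytic series
   that is constant on most of the circle, and by a theorem of Privalov type
   (analytic_uniqueness) the constant is its zeroth coefficient, which
   vanishes.  Write a Brownian loop as the independent sum of a function
   of the path before a time close to 2 pi and a function of the increments
   after it.  With the first summand fixed, two loops in PLA differ by a linear
   function up to that time, its slope being governed by the last increment; so
   the last increment is determined, an event of probability zero.  Fubini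
   concludes, once PLA is replaced by measurable subsets: PLA is a Souslin set,
   and a capacitability argument reduces its nullity to that of closed sets.

   Uniqueness: a partial sum P is bounded on a Privalov domain, small near the
   unit circle, and the maximum principle applied to P B ^ K, where B is an
   explicit rational function that is small above the gaps of the good set and
   close to 1 at the origin, bounds its value at 0. *)
Require Import Defs.
From HB Require Import structures.
From mathcomp Require Import all_boot all_order all_algebra.
From mathcomp Require Import all_classical all_reals all_analysis.
From mathcomp Require Import measurable_realfun.
From mathcomp Require Import complex ring lra.

Import Order.TTheory GRing.Theory Num.Theory numFieldNormedType.Exports.
Import ComplexField.Normc.
Local Open Scope classical_set_scope.
Local Open Scope ring_scope.
Local Open Scope complex_scope.

Set Implicit Arguments.
Unset Strict Implicit.
Unset Printing Implicit Defensive.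

(** * The maximum principle *)

(** The coefficients of a sum need not be its Fourier coefficients, so none of them can be recovered
    by integrating f. The rigidity used instead is that uniform convergence to 0 on a large part of
    the circle, not of full measure, forces the zeroth coefficient to vanish. Two loops therefore
    need to be compared only up to [cut_time]. Their difference there is linear because closing a
    path subtracts t / 2pi times its end value: new increments after the cut are felt before it only
    through that value. A translation by [al] turns t into the constant [al] and multiplies the n-th
    coefficient by e^(i n al) - 1, which is 0 for n = 0. Membership in PLA quantifies over all
    coefficient sequences and is not visibly measurable, so a.e. convergence is replaced by Egorov
    conditions with explicit rates. The thresholds 1/2, 1 and 2 times 2^-j in [prelevel], [level]
    and [almost_unif] leave room first for rational approximation and then for a limit in the
    coefficients. The power [K] of the barrier turns the fixed gap between 5/6 and (19/20)^2 into a
    factor that beats the uncontrolled bound [M] on the partial sums. *)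

Section modulus.
Variable R : realType.
Implicit Types (z w : R[i]) (x : R).

Lemma addcE (a b c d : R) : (a +i* b) + (c +i* d) = (a + c) +i* (b + d).
Proof. by []. Qed.

Lemma oppcE (a b : R) : - (a +i* b) = (- a) +i* (- b).
Proof. by []. Qed.

Lemma mulcE (a b c d : R) :
  (a +i* b) * (c +i* d) = (a * c - b * d) +i* (a * d + b * c).
Proof. by []. Qed.

Definition nsq z : R := complex.Re z ^+ 2 + complex.Im z ^+ 2.

Lemma sqr_normcE z : normc z ^+ 2 = nsq z.
Proof. by case: z => a b; rewrite /nsq /= sqr_sqrtr// addr_ge0 ?sqr_ge0. Qed.

Lemma normc_ge0 z : 0 <= normc z.
Proof. by case: z => a b /=; exact: sqrtr_ge0. Qed.

Lemma nsqM z w : nsq (z * w) = nsq z * nsq w.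
Proof. by rewrite -!sqr_normcE normcM exprMn. Qed.

Lemma normcX z n : normc (z ^+ n) = normc z ^+ n.
Proof.
by elim: n => [|n IH]; rewrite ?expr0 ?normc1// !exprS normcM IH.
Qed.

Lemma normc_sum (I : Type) (s : seq I) (F : I -> R[i]) :
  normc (\sum_(i <- s) F i) <= \sum_(i <- s) normc (F i).
Proof.
elim: s => [|a s IH]; first by rewrite !big_nil normc0.
by rewrite !big_cons (le_trans (le_normcD _ _))// lerD2l.
Qed.

Lemma normc_real x : normc x%:C = `|x|.
Proof. by rewrite /= expr0n addr0 sqrtr_sqr. Qed.

Lemma normc_Re z : `|complex.Re z| <= normc z.
Proof.
case: z => a b /=; rewrite -(sqrtr_sqr a) ler_sqrt ?addr_ge0 ?sqr_ge0//.
by rewrite lerDl sqr_ge0.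
Qed.

Lemma normc_Im z : `|complex.Im z| <= normc z.
Proof.
case: z => a b /=; rewrite -(sqrtr_sqr b) ler_sqrt ?addr_ge0 ?sqr_ge0//.
by rewrite lerDr sqr_ge0.
Qed.

Lemma normc_ReIm z : normc z <= `|complex.Re z| + `|complex.Im z|.
Proof.
case: z => a b /=; rewrite -[leRHS]ger0_norm ?addr_ge0// -sqrtr_sqr ler_wsqrtr//.
rewrite sqrrD !real_normK ?num_real// -addrA lerD2l lerDr.
by rewrite mulrn_wge0// mulr_ge0.
Qed.

Lemma normcB z w : normc (z - w) = normc (w - z).
Proof. by rewrite -normcN opprB. Qed.

Lemma le_normcB z w : normc z - normc w <= normc (z - w).
Proof. by rewrite lerBlDr -{1}(subrK w z) le_normcD. Qed.

End modulus.

Section max_principle.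
Variable R : realType.
Implicit Types (z w : R[i]) (G H : R[i] -> R[i]) (x : R).

(* Second order Taylor expansion with cubic remainder: the only consequence of
   holomorphy that the maximum principle below uses. *)
Definition taylor2 G z0 := exists g1 g2 E (K rho : R), 0 < rho /\
  forall w, normc w <= rho -> normc (E w) <= K /\
    G (z0 + w) = G z0 + g1 * w + g2 * w ^+ 2 + w ^+ 3 * E w.

Lemma taylor2_cst c z0 : taylor2 (fun=> c) z0.
Proof.
exists 0, 0, (fun=> 0), 0, 1; split => // w _; rewrite normc0; split => //; ring.
Qed.

Lemma taylor2_id z0 : taylor2 id z0.
Proof.
exists 1, 0, (fun=> 0), 0, 1; split => // w _; rewrite normc0; split => //; ring.
Qed.

Lemma taylor2D G H z0 :
  taylor2 G z0 -> taylor2 H z0 -> taylor2 (fun z => G z + H z) z0.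
Proof.
move=> [g1 [g2 [E [K [r [r0 hG]]]]]] [h1 [h2 [F [L [s [s0 hH]]]]]].
exists (g1 + h1), (g2 + h2), (fun w => E w + F w), (K + L), (Num.min r s).
split; first by rewrite lt_min r0.
move=> w; rewrite le_min => /andP[/hG[e1 ->] /hH[e2 ->]]; split; last by ring.
by rewrite (le_trans (le_normcD _ _))// lerD.
Qed.

Lemma taylor2M G H z0 :
  taylor2 G z0 -> taylor2 H z0 -> taylor2 (fun z => G z * H z) z0.
Proof.
move=> [g1 [g2 [E [K [r [r0 hG]]]]]] [h1 [h2 [F [L [s [s0 hH]]]]]].
set g0 := G z0; set h0 := H z0.
(* The terms of order at least 3 of the product, divided by w ^+ 3 and bounded termwise; the radius
   is capped at 1 so that powers of w have modulus at most 1. *)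
pose B := normc g1 * normc h2 + normc g2 * normc h1 + normc g2 * normc h2
  + K * (normc h0 + normc h1 + normc h2)
  + (normc g0 + normc g1 + normc g2) * L + K * L.
exists (g0 * h1 + g1 * h0), (g0 * h2 + g1 * h1 + g2 * h0), (fun w =>
  g1 * h2 + g2 * h1 + g2 * h2 * w + E w * (h0 + h1 * w + h2 * w ^+ 2)
  + (g0 + g1 * w + g2 * w ^+ 2) * F w + w ^+ 3 * (E w * F w)), B,
  (Num.min (Num.min r s) 1).
split; first by rewrite !lt_min r0 s0 ltr01.
move=> w; rewrite !le_min => /andP[/andP[/hG[e1 ->] /hH[e2 ->]]] w1; split; last first.
  by rewrite /g0 /h0; ring.
have nX n : normc (w ^+ n) <= 1 by rewrite normcX exprn_ile1 ?normc_ge0.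
have nM a b (c d : R) : normc a <= c -> normc b <= d -> normc (a * b) <= c * d.
  by move=> ? ?; rewrite normcM ler_pM ?normc_ge0.
have nMX a n (c : R) : normc a <= c -> normc (a * w ^+ n) <= c.
  by move=> ?; rewrite -(mulr1 c) nM.
have nD a b (c d : R) : normc a <= c -> normc b <= d -> normc (a + b) <= c + d.
  by move=> ? ?; rewrite (le_trans (le_normcD _ _))// lerD.
have nM1 a (c : R) : normc a <= c -> normc (a * w) <= c.
  by move=> ?; rewrite -[w]expr1 nMX.
rewrite [w ^+ 3 * _]mulrC.
by do ?apply: (nD); do ?[apply: (nMX)]; do ?[apply: (nM1)]; do ?[apply: (nM)];
  rewrite ?lexx//; do ?apply: (nD); do ?[apply: (nMX)]; do ?[apply: (nM1)].
Qed.

Lemma taylor2X G z0 n : taylor2 G z0 -> taylor2 (fun z => G z ^+ n) z0.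
Proof.
move=> hG; elim: n => [|n IH].
  by under eq_fun do rewrite expr0; exact: taylor2_cst.
by under eq_fun do rewrite exprS; exact: taylor2M.
Qed.

Lemma taylor2_sum (I : Type) (s : seq I) (F : I -> R[i] -> R[i]) z0 :
  (forall i, taylor2 (F i) z0) -> taylor2 (fun z => \sum_(i <- s) F i z) z0.
Proof.
move=> hF; elim: s => [|a s IH].
  by under eq_fun do rewrite big_nil; exact: taylor2_cst.
by under eq_fun do rewrite big_cons; exact: taylor2D.
Qed.

Lemma taylor2_prod (I : Type) (s : seq I) (F : I -> R[i] -> R[i]) z0 :
  (forall i, taylor2 (F i) z0) -> taylor2 (fun z => \prod_(i <- s) F i z) z0.
Proof.
move=> hF; elim: s => [|a s IH].
  by under eq_fun do rewrite big_nil; exact: taylor2_cst.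
by under eq_fun do rewrite big_cons; exact: taylor2M.
Qed.

(** The geometric series for 1 / (d - k w), stopped after three terms, has exact remainder w^3 k^3 /
    (d^3 (d - k w)). The radius keeps |k w| below |d| / 2, and the 1 added to |k| covers k = 0. *)
Lemma taylor2_affineV a k z0 :
  a - k * z0 != 0 -> taylor2 (fun z => (a - k * z)^-1) z0.
Proof.
set d := a - k * z0 => d0.
have nd0 : 0 < normc d.
  rewrite lt_def normc_ge0 andbT; apply: contra d0 => /eqP h.
  by apply/eqP; exact: eq0_normc.
have k10 : 0 < normc k + 1 by rewrite ltr_wpDl ?normc_ge0.
exists (k / d ^+ 2), (k ^+ 2 / d ^+ 3), (fun w => k ^+ 3 / (d ^+ 3 * (d - k * w))),
  (normc k ^+ 3 / (normc d ^+ 3 * (normc d / 2))), (normc d / 2 / (normc k + 1)).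
split; first by rewrite divr_gt0// divr_gt0.
move=> w; rewrite ler_pdivlMr// => hw.
have hkw : normc (k * w) <= normc d / 2.
  rewrite normcM (le_trans _ hw)// mulrC ler_wpM2l ?normc_ge0//.
  by rewrite lerDl.
have hd : normc d / 2 <= normc (d - k * w).
  by rewrite (le_trans _ (le_normcB _ _))//; lra.
have dw0 : d - k * w != 0.
  by apply/eqP => h; move: hd; rewrite h normc0; lra.
split.
  rewrite normcM normcX normcV normcM normcX ler_wpM2l ?exprn_ge0 ?normc_ge0//.
  rewrite lef_pV2 ?posrE ?mulr_gt0 ?exprn_gt0 ?divr_gt0//; last first.
    by rewrite (lt_le_trans _ hd)// divr_gt0.
  by rewrite ler_wpM2l ?exprn_ge0 ?normc_ge0.
have -> : a - k * (z0 + w) = d - k * w by rewrite /d; ring.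
rewrite -/d; field.
by rewrite dw0 d0.
Qed.

Let nsqD_ge z w : nsq z - 2 * normc z * normc w <= nsq (z + w).
Proof.
rewrite -!sqr_normcE; have := le_normcB (z + w) w; have := le_normcD (z + w) (- w).
rewrite addrK normcN; have := normc_ge0 z; have := normc_ge0 w.
have := normc_ge0 (z + w).
set a := normc z; set b := normc w; set c := normc (z + w) => c0 b0 a0 abc _.
have [ba|ab] := lerP b a; last by nra.
have : (a - b) ^+ 2 <= c ^+ 2 by rewrite lerXn2r ?nnegrE ?subr_ge0//; lra.
nra.
Qed.

Let parallelogram4 (a b c : R[i]) (h : R) :
  nsq (a + b * h%:C + c * h%:C ^+ 2) + nsq (a + b * - h%:C + c * (- h%:C) ^+ 2)
    + nsq (a + b * (h%:C * 'i) + c * (h%:C * 'i) ^+ 2)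
    + nsq (a + b * - (h%:C * 'i) + c * (- (h%:C * 'i)) ^+ 2)
  = 4 * nsq a + 4 * nsq b * h ^+ 2 + 4 * nsq c * h ^+ 4.
Proof.
case: a b c => [a0 b0] [a1 b1] [a2 b2]; rewrite !expr2 !(mulcE, addcE, oppcE) /nsq /=.
ring.
Qed.

(** A discrete sub-mean value property. Over the four points h, -h, ih, -ih both the sum of w and
    the sum of w^2 vanish, so all cross terms of the quadratic polynomial cancel; two opposite
    points would leave the product of [g0] and [g2] at order h^2. Only the cubic remainder is
    lost. *)
Lemma taylor2_mean G z0 : taylor2 G z0 -> exists (K h0 : R), 0 < h0 /\
  forall h : R, 0 < h <= h0 ->
   4 * nsq (G z0) - K * h ^+ 3 <=
   nsq (G (z0 + h%:C)) + nsq (G (z0 - h%:C))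
   + nsq (G (z0 + h%:C * 'i)) + nsq (G (z0 - h%:C * 'i)).
Proof.
move=> [g1 [g2 [E [K [r [r0 hG]]]]]]; set g0 := G z0.
pose B := normc g0 + normc g1 + normc g2.
exists (8 * B * K), (Num.min r 1); split; first by rewrite lt_min r0 ltr01.
move=> h; rewrite le_min => /andP[h0 /andP[hr h1]].
have key w : normc w = h -> nsq (g0 + g1 * w + g2 * w ^+ 2) - 2 * B * K * h ^+ 3
    <= nsq (G (z0 + w)).
  move=> nw; have [|hE ->] := hG w; first by rewrite nw.
  rewrite -/g0 (le_trans _ (nsqD_ge _ _))// lerB//.
  have h3 : 0 <= h ^+ 3 by rewrite exprn_ge0// ltW.
  rewrite normcM normcX nw.
  have -> : 2 * B * K * h ^+ 3 = 2 * B * (h ^+ 3 * K) by ring.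
  have hp : normc (g0 + g1 * w + g2 * w ^+ 2) <= B.
    apply: le_trans (le_normcD _ _) _; apply: lerD.
      apply: le_trans (le_normcD _ _) _; rewrite lerD2l normcM nw.
      by rewrite ler_piMr ?normc_ge0.
    by rewrite normcM normcX nw ler_piMr ?normc_ge0// exprn_ile1// ltW.
  by apply: ler_pM; rewrite ?ler_wpM2l ?mulr_ge0 ?normc_ge0// ltW.
have ni : normc ('i : R[i]) = 1 by rewrite /= expr0n expr1n add0r sqrtr1.
have nh : normc (h%:C) = h by rewrite normc_real gtr0_norm.
have := key (h%:C) nh; have := key (- h%:C); rewrite normcN => /(_ nh).
have := key (h%:C * 'i); rewrite normcM nh ni mulr1 => /(_ erefl).
have := key (- (h%:C * 'i)); rewrite normcN normcM nh ni mulr1 => /(_ erefl).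
have := parallelogram4 g0 g1 g2 h.
have : 0 <= 4 * nsq g1 * h ^+ 2 + 4 * nsq g2 * h ^+ 4.
  by rewrite addr_ge0 ?mulr_ge0 ?addr_ge0 ?sqr_ge0 ?exprn_ge0// ltW.
lra.
Qed.

Definition toC (p : R * R) : R[i] := p.1 +i* p.2.

Lemma taylor2_continuous G p : taylor2 G (toC p) ->
  {for p, continuous (fun q => nsq (G (toC q)))}.
Proof.
move=> [g1 [g2 [E [K [r [r0 hG]]]]]]; set g0 := G (toC p).
pose B := normc g1 + normc g2 + K.
have hB w : normc w <= Num.min r 1 ->
    `|nsq (G (toC p + w)) - nsq g0| <= (2 * normc g0 + B) * B * normc w.
  rewrite le_min => /andP[/hG[hE ->] w1]; rewrite -/g0.
  have K0 : 0 <= K by rewrite (le_trans _ hE)// normc_ge0.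
  have B0 : 0 <= B by rewrite !addr_ge0 ?normc_ge0.
  have nw0 := normc_ge0 w; have g00 := normc_ge0 g0.
  set u := g1 * w + g2 * w ^+ 2 + w ^+ 3 * E w.
  have uB : normc u <= B * normc w.
    rewrite /B !mulrDl /u; apply: le_trans (le_normcD _ _) _; apply: lerD.
      apply: le_trans (le_normcD _ _) _; rewrite [normc (g1 * w)]normcM lerD2l.
      by rewrite [normc (g2 * _)]normcM normcX ler_wpM2l ?normc_ge0// expr2 ler_piMl.
    rewrite [normc (_ * E w)]normcM normcX mulrC; apply: ler_pM; rewrite ?normc_ge0 ?exprn_ge0//.
    by rewrite exprS ler_piMr// exprn_ile1.
  have -> : g0 + g1 * w + g2 * w ^+ 2 + w ^+ 3 * E w = g0 + u by rewrite /u; ring.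
  rewrite -!sqr_normcE subr_sqr normrM mulrC.
  have h1 : `|normc (g0 + u) - normc g0| <= normc u.
    rewrite ler_norml; apply/andP; split.
      have := le_normcB g0 (- u); rewrite opprK normcN; lra.
    by have := le_normcD g0 u; lra.
  have uB' : normc u <= B by rewrite (le_trans uB)// ler_piMr.
  have h2 : `|normc (g0 + u) + normc g0| <= 2 * normc g0 + B.
    rewrite ger0_norm ?addr_ge0 ?normc_ge0//.
    by have := le_normcD g0 u; lra.
  by rewrite -mulrA ler_pM// (le_trans h1).
apply/cvgrPdist_le => /= e e0.
set D := (2 * normc g0 + B) * B.
have D0 : 0 < `|D| + 1 by rewrite ltr_wpDl.
pose d := Num.min (Num.min r 1) (e / (`|D| + 1)) / 2.
have d0 : 0 < d by rewrite divr_gt0// !lt_min r0 ltr01 divr_gt0.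
near=> q.
have hq1 : `|p.1 - q.1| < d.
  near: q; apply: (@cvgr_dist_lt _ _ _ (nbhs p) _ fst p.1) => //; exact: cvg_fst.
have hq2 : `|p.2 - q.2| < d.
  near: q; apply: (@cvgr_dist_lt _ _ _ (nbhs p) _ snd p.2) => //; exact: cvg_snd.
have nqp : normc (toC q - toC p) <= 2 * d.
  rewrite (le_trans (normc_ReIm _))//= -[_ - p.1]opprB -[_ - p.2]opprB !normrN.
  by lra.
have dE : 2 * d = Num.min (Num.min r 1) (e / (`|D| + 1)) by rewrite /d; field.
have : normc (toC q - toC p) <= Num.min r 1.
  by rewrite (le_trans nqp)// dE ge_min lexx.
move=> /hB; rewrite [toC p + _]addrC subrK distrC => /le_trans; apply.
have : normc (toC q - toC p) <= e / (`|D| + 1).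
  by rewrite (le_trans nqp)// dE ge_min lexx orbT.
rewrite ler_pdivlMr//; apply: le_trans.
rewrite -/D mulrC ler_wpM2l ?normc_ge0//.
by rewrite (le_trans (ler_norm _))// lerDl.
Unshelve. all: by end_near. Qed.

Lemma max_principle (Q : set (R * R)) G (m : R) : compact Q ->
  (forall p, Q p -> nsq (toC p) <= 1) ->
  (forall p, Q p -> taylor2 G (toC p)) ->
  (forall p, Q p -> nsq (G (toC p)) <= m \/
     exists2 rho : R, 0 < rho & forall q, `|q.1 - p.1| < rho -> `|q.2 - p.2| < rho -> Q q) ->
  forall p, Q p -> nsq (G (toC p)) <= m.
Proof.
move=> cQ Q1 QT Qm p0 Qp0; rewrite leNgt; apply/negP => mp0.
(* Adding e |z|^2 makes the function strictly subharmonic. As |z| <= 1 on [Q], this costs at most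
   [e], while the excess over [m] at [p0] is 2e, so the maximum of [psi] cannot sit where nsq G <=
   m. *)
pose e := (nsq (G (toC p0)) - m) / 2.
have e0 : 0 < e by rewrite divr_gt0// subr_gt0.
pose psi p := nsq (G (toC p)) + e * nsq (toC p).
have [||p /set_mem Qp hp] := @compact_EVT_max _ R psi Q _ cQ.
- by exists p0.
- apply: continuous_in_subspaceT => q /set_mem Qq.
  apply: cvgD; first exact: (taylor2_continuous (QT _ Qq)).
  by apply: cvgM; [exact: cvg_cst|exact: (taylor2_continuous (taylor2_id _))].
have hpsi q : Q q -> psi q <= psi p by move=> Qq; apply: hp; exact: mem_set.
have [mp|[rho rho0 hrho]] := Qm _ Qp.
  have := hpsi _ Qp0; rewrite /psi.
  have : 0 <= e * nsq (toC p0) by rewrite mulr_ge0 ?(ltW e0)// addr_ge0 ?sqr_ge0.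
  have : e * nsq (toC p) <= e by rewrite ler_piMr ?Q1// ltW.
  have : nsq (G (toC p0)) = m + 2 * e by rewrite /e; field.
  lra.
have [K [h0 [h00 hK]]] := taylor2_mean (QT _ Qp).
(* At an interior maximum the four-point inequality gives 4 e h^2 <= K h^3, which contradicts K h <=
   e. *)
pose h := Num.min (Num.min h0 (rho / 2)) (e / (`|K| + 1)).
have K0 : 0 < `|K| + 1 by rewrite ltr_wpDl.
have hpos : 0 < h by rewrite /h !lt_min h00 (divr_gt0 e0 K0) divr_gt0.
have hh0 : h <= h0 by rewrite /h !ge_min lexx.
have hhr : h < rho.
  by rewrite (@le_lt_trans _ _ (rho / 2))// ?ltr_pdivrMr ?ltr_pMr ?ltr1n// /h !ge_min lexx orbT.
have hhK : h * (`|K| + 1) <= e by rewrite -ler_pdivlMr// /h ge_min lexx orbT.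
have := hK h; rewrite hpos hh0 => /(_ isT).
have q1 : toC p + h%:C = toC (p.1 + h, p.2).
  by rewrite addcE addr0.
have q2 : toC p - h%:C = toC (p.1 - h, p.2).
  by rewrite oppcE addcE oppr0 addr0.
have q3 : toC p + h%:C * 'i = toC (p.1, p.2 + h).
  by rewrite /toC mulcE addcE; congr Complex => /=; ring.
have q4 : toC p - h%:C * 'i = toC (p.1, p.2 - h).
  by rewrite /toC mulcE oppcE addcE; congr Complex => /=; ring.
rewrite q1 q2 q3 q4.
have Qi (q : R * R) : `|q.1 - p.1| <= h -> `|q.2 - p.2| <= h -> psi q <= psi p.
  by move=> a b; apply: hpsi; apply: hrho; [exact: le_lt_trans a _|exact: le_lt_trans b _].
have z1 a : a + h - a = h by ring.
have z2 a : a - h - a = - h by ring.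
have := Qi (p.1 + h, p.2); rewrite /= subrr z1 normr0 gtr0_norm// => /(_ (lexx _) (ltW hpos)).
have := Qi (p.1 - h, p.2); rewrite /= subrr z2 normr0 normrN gtr0_norm//
  => /(_ (lexx _) (ltW hpos)).
have := Qi (p.1, p.2 + h); rewrite /= subrr z1 normr0 gtr0_norm// => /(_ (ltW hpos) (lexx _)).
have := Qi (p.1, p.2 - h); rewrite /= subrr z2 normr0 normrN gtr0_norm//
  => /(_ (ltW hpos) (lexx _)).
rewrite /psi.
have -> : nsq (toC (p.1 + h, p.2)) = nsq (toC p) + 2 * h * p.1 + h ^+ 2 by rewrite /nsq /=; ring.
have -> : nsq (toC (p.1 - h, p.2)) = nsq (toC p) - 2 * h * p.1 + h ^+ 2 by rewrite /nsq /=; ring.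
have -> : nsq (toC (p.1, p.2 + h)) = nsq (toC p) + 2 * h * p.2 + h ^+ 2 by rewrite /nsq /=; ring.
have -> : nsq (toC (p.1, p.2 - h)) = nsq (toC p) - 2 * h * p.2 + h ^+ 2 by rewrite /nsq /=; ring.
move=> a1 a2 a3 a4 a5.
have : 4 * e * h ^+ 2 <= K * h ^+ 3 by lra.
have -> : K * h ^+ 3 = h ^+ 2 * (K * h) by ring.
rewrite mulrC ler_pM2l ?exprn_gt0//.
have : K * h <= e.
  by rewrite (le_trans _ hhK)// mulrC ler_wpM2l ?(ltW hpos)// (le_trans (ler_norm _))// lerDl.
lra.
Qed.

End max_principle.

(** * Abel summation and the barrier function *)

Section expi.
Variable R : realType.
Implicit Types (a b t : R) (z w : R[i]).

Lemma expiD a b : expi (a + b) = expi a * expi b.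
Proof. by rewrite /expi mulcE cosD sinD; congr Complex; ring. Qed.

Lemma expi0 : expi 0 = 1 :> R[i].
Proof. by rewrite /expi cos0 sin0. Qed.

Lemma expiNM t : expi (- t) * expi t = 1.
Proof. by rewrite -expiD addNr expi0. Qed.

Lemma expiX t n : expi (n%:R * t) = expi t ^+ n.
Proof.
elim: n => [|n IH]; first by rewrite mul0r expi0.
by rewrite exprSr -IH -expiD -natr1; congr expi; ring.
Qed.

Lemma normc_expi t : normc (expi t) = 1.
Proof. by rewrite /expi/= cos2Dsin2 sqrtr1. Qed.

Lemma expi2pi t : expi (t + 2 * pi) = expi t.
Proof.
have -> : t + 2 * pi = t + pi *+ 2 by rewrite mulr_natl.
by rewrite /expi cosD2pi sinD2pi.
Qed.

Lemma normr_sin_le t : `|sin t| <= `|t|.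
Proof.
wlog t0 : t / 0 <= t.
  move=> h; have [|/ltW t0] := leP 0 t; first exact: h.
  by rewrite -(normrN t) -(normrN (sin t)) -sinN; apply: h; rewrite oppr_ge0.
have [|c _] := @MVT_segment R sin cos 0 t t0.
  by apply: continuous_subspaceT; exact: continuous_sin.
rewrite sin0 !subr0 => ->; rewrite normrM ler_piMl//; exact: cos_max.
Qed.

(** A chord is shorter than its arc: the squared chord is 4 sin^2 ((a - b) / 2). *)
Lemma normc_expiB a b : normc (expi a - expi b) <= `|a - b|.
Proof.
rewrite -(@ler_pXn2r _ 2) ?nnegrE ?normc_ge0// sqr_normcE.
have -> : nsq (expi a - expi b) = 2 - 2 * cos (a - b).
  rewrite /expi oppcE addcE /nsq /= cosB.
  have := cos2Dsin2 a; have := cos2Dsin2 b; lra.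
have {1}-> : a - b = (a - b) / 2 + (a - b) / 2 by field.
rewrite cosD; have := cos2Dsin2 ((a - b) / 2).
have : `|sin ((a - b) / 2)| ^+ 2 <= `|(a - b) / 2| ^+ 2.
  by rewrite ler_pXn2r ?nnegrE//; exact: normr_sin_le.
rewrite !real_normK ?num_real//.
set s := sin _; set c := cos _; nra.
Qed.

Lemma polar z : exists2 t, t \in `[0, 2 * pi[ & z = (normc z)%:C * expi t.
Proof.
have pi0 := pi_gt0 R.
have [z0|z0] := eqVneq (normc z) 0.
  exists 0; first by rewrite in_itv/= lexx mulr_gt0.
  by rewrite z0 mul0r; exact: eq0_normc.
have nz : 0 < normc z by rewrite lt_def z0 normc_ge0.
pose x := complex.Re z / normc z; pose y := complex.Im z / normc z.
have xy : x ^+ 2 + y ^+ 2 = 1.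
  by rewrite !expr_div_n -mulrDl -/(nsq z) -sqr_normcE divff// expf_neq0.
have zxy : z = (normc z)%:C * (x +i* y).
  have {1}-> : z = complex.Re z +i* complex.Im z by case: (z).
  by rewrite mulcE /x /y; congr Complex; field; exact: z0.
have x1 : -1 <= x <= 1.
  rewrite -ler_norml -(@ler_pXn2r _ 2) ?nnegrE// real_normK ?num_real//.
  by have := sqr_ge0 y; lra.
have [/andP[a0 api] ca] := acos_def x1.
have sy : Num.sqrt (1 - x ^+ 2) = `|y|.
  by rewrite -xy addrC addKr sqrtr_sqr.
have [y0|y0] := leP 0 y.
  exists (acos x); first by rewrite in_itv/= a0/= (le_lt_trans api)//; lra.
  by rewrite {1}zxy /expi sin_acos// ca sy ger0_norm.
have acos0 : 0 < acos x.
  rewrite lt_def a0 andbT; apply/eqP => h; move: ca sy; rewrite h cos0 => <-.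
  by rewrite expr1n subrr sqrtr0 => /esym/eqP; rewrite normr_eq0 => /eqP; lra.
exists (2 * pi - acos x); first by rewrite in_itv/=; apply/andP; split; lra.
rewrite {1}zxy addrC expi2pi /expi cosN sinN sin_acos// ca sy ltr0_norm//.
by rewrite opprK.
Qed.

End expi.

Section abel.
Variable R : realType.
Implicit Types (c : nat -> R[i]) (z w : R[i]) (t : R).

Definition psum c (n : nat) t : R[i] := series (fun k => c k * expi (k%:R * t)) n.

Definition trunc c (n : nat) z : R[i] := \sum_(0 <= k < n) c k * z ^+ k.

Lemma psumS c n t : psum c n.+1 t = psum c n t + c n * expi (n%:R * t).
Proof. by rewrite /psum seriesEnat /= big_nat_recr. Qed.

Lemma psum0 c t : psum c 0 t = 0.
Proof. by rewrite /psum seriesEnat /= big_geq. Qed.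

(** Summation by parts along the radius through e^(it): values inside the disc are expressed by the
    partial sums at the boundary point, the only quantities under control. *)
Lemma truncE_abel c n w t : trunc c n (expi t * w) =
    (1 - w) * (\sum_(0 <= k < n) psum c k.+1 t * w ^+ k) + psum c n t * w ^+ n.
Proof.
elim: n => [|n IH].
  by rewrite /trunc !big_geq// psum0; ring.
rewrite /trunc big_nat_recr//= [in RHS]big_nat_recr//= -/(trunc c n _) IH psumS.
rewrite exprMn expiX exprS; ring.
Qed.

(** The last hypothesis places z in a Stolz region at e^(it), that is |1 - w| <= 2 (1 - r). The
    first [N] terms of the Abel sum cost [M] each; the later ones form a geometric series whose sum
    is cancelled by 1 - r, giving 2 [eta]; the boundary term of the summation by parts gives one
    more [eta]. *)
Lemma trunc_le c N n z t (M eta : R) : (N <= n)%N -> 0 <= eta -> normc z < 1 ->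
  (forall k, normc (psum c k t) <= M) ->
  (forall k, (N <= k)%N -> normc (psum c k t) <= eta) ->
  normc (z - expi t) <= 2 * (1 - normc z) ->
  normc (trunc c n z) <= 2 * (1 - normc z) * N%:R * M + 3 * eta.
Proof.
move=> Nn eta0 z1 hM heta hz.
have M0 : 0 <= M by rewrite (le_trans _ (hM 0%N))// normc_ge0.
set w := expi (- t) * z; set r := normc z.
have wr : normc w = r by rewrite normcM normc_expi mul1r.
have r0 : 0 <= r by rewrite normc_ge0.
have w1 : normc (1 - w) <= 2 * (1 - r).
  rewrite -(expiNM t) -mulrBr normcM normc_expi mul1r normcB; exact: hz.
have -> : z = expi t * w by rewrite /w mulrA [expi t * _]mulrC expiNM mul1r.
rewrite truncE_abel (le_trans (le_normcD _ _))//.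
have -> : 2 * (1 - r) * N%:R * M + 3 * eta =
  (2 * (1 - r) * N%:R * M + 2 * eta) + eta by ring.
apply: lerD; last first.
  rewrite normcM normcX wr -[leRHS]mulr1 ler_pM ?normc_ge0 ?exprn_ge0// ?heta//.
  by rewrite exprn_ile1// ltW.
rewrite normcM.
have r1 : 0 < 1 - r by rewrite subr_gt0.
have geo n' : (1 - r) * (\sum_(0 <= k < n') r ^+ k) <= 1.
  have -> : (1 - r) * (\sum_(0 <= k < n') r ^+ k) = 1 - r ^+ n'.
    elim: n' => [|m IH]; first by rewrite big_geq// expr0; ring.
    by rewrite big_nat_recr//= mulrDr IH exprS; ring.
  by rewrite gerBl exprn_ge0.
have sumle : normc (\sum_(0 <= k < n) psum c k.+1 t * w ^+ k) <=
    N%:R * M + eta * \sum_(0 <= k < n) r ^+ k.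
  rewrite (le_trans (normc_sum _ _))//.
  rewrite (@big_cat_nat _ _ _ N 0 n)//=; apply: lerD.
    have -> : N%:R * M = \sum_(0 <= k < N) M by rewrite sumr_const_nat subn0 mulr_natl.
    apply: ler_sum => k _.
    rewrite normcM normcX wr -[leRHS]mulr1 ler_pM ?normc_ge0 ?exprn_ge0// exprn_ile1//.
    exact: ltW.
  rewrite mulr_sumr [in leRHS](@big_cat_nat _ _ _ N 0 n)//= ler_wpDl//.
    by rewrite sumr_ge0// => k _; rewrite mulr_ge0// exprn_ge0.
  rewrite !big_nat; apply: ler_sum => k /andP[Nk _].
  by rewrite normcM normcX wr ler_wpM2r ?exprn_ge0// heta// leqW.
rewrite (le_trans (ler_pM (normc_ge0 _) (normc_ge0 _) w1 sumle))//.
have := ler_wpM2l eta0 (geo n); set G := \sum_(0 <= k < n) _; lra.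
Qed.

End abel.

Section barrier.
Variable R : realType.
Implicit Types (z w : R[i]) (n : nat) (m th : nat -> R).

Definition bnum th n z : R[i] := \prod_(0 <= j < n) (1 - expi (- th j) * z).

Definition bden m th n z : R[i] :=
  \prod_(0 <= j < n) (1 + (m j)%:C - expi (- th j) * z).

(* The substitute for exp(-U), U the Herglotz transform of the measure with
   masses m j at the points th j. *)
Definition barrier m th n z : R[i] := \prod_(0 <= j < n)
   ((1 - expi (- th j) * z) * (1 + (m j)%:C - expi (- th j) * z)^-1).

Lemma Re_le_normc w : complex.Re w <= normc w.
Proof. by rewrite (le_trans (ler_norm _))// normc_Re. Qed.

Lemma Re_oneB w : 1 - normc w <= complex.Re (1 - w).
Proof.
case: w => a b; rewrite -[complex.Re _]/(1 - a) lerD2l lerN2.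
exact: (Re_le_normc (a +i* b)).
Qed.

Lemma nsq_addr w (x : R) :
  nsq (w + x%:C) = nsq w + 2 * x * complex.Re w + x ^+ 2.
Proof. by case: w => a b; rewrite addcE /nsq /=; ring. Qed.

Lemma nsq_gt0 w : w != 0 -> 0 < nsq w.
Proof.
move=> w0; rewrite -sqr_normcE exprn_gt0// lt_def normc_ge0 andbT.
by apply: contra w0 => /eqP/eq0_normc ->.
Qed.

Lemma barrierE m th n z :
  barrier m th n z = bnum th n z / bden m th n z.
Proof. by rewrite /barrier /bnum /bden big_split/= prodfV. Qed.

Lemma bden_factor_neq0 m th j z : (forall j, 0 <= m j) -> normc z < 1 ->
  1 + (m j)%:C - expi (- th j) * z != 0.
Proof.
move=> m0 z1; apply/eqP => /(congr1 (@complex.Re R)) /=.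
have := Re_oneB (expi (- th j) * z); rewrite normcM normc_expi mul1r.
have : complex.Re (1 + (m j)%:C - expi (- th j) * z) =
   m j + complex.Re (1 - expi (- th j) * z).
  by case: (expi _ * z) => a b; rewrite oppcE !addcE /=; ring.
by have := m0 j; move=> ? -> ? ; lra.
Qed.

(** With s = 1 - |z| and u = 1 - e^(-i th) z one has Re u >= s, and |u| <= 3s at the nodes selected
    by [J]. Hence |u + m|^2 >= |u|^2 + 2 m s >= |u|^2 (1 + 2m / 9s) there, and a total selected mass
    of at least s yields the factor 1 + 2/9 = 11/9. *)
Lemma bden_ge m th n z (J : pred nat) : (forall j, 0 <= m j) -> normc z < 1 ->
  (forall j, (j < n)%N -> J j ->
    normc (z - expi (th j)) <= 3 * (1 - normc z)) ->
  1 - normc z <= \sum_(0 <= j < n | J j) m j ->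
  11 * nsq (bnum th n z) <= 9 * nsq (bden m th n z).
Proof.
move=> m0 z1 hJ hs; set s := 1 - normc z.
have s0 : 0 < s by rewrite subr_gt0.
pose u j : R[i] := 1 - expi (- th j) * z.
have u1 j : s <= complex.Re (u j).
  by rewrite (le_trans _ (Re_oneB _))// normcM normc_expi mul1r.
have dE j : 1 + (m j)%:C - expi (- th j) * z = u j + (m j)%:C.
  by rewrite /u; ring.
have key k : (k <= n)%N ->
    (1 + 2 / (9 * s) * \sum_(0 <= j < k | J j) m j) * nsq (bnum th k z)
    <= nsq (bden m th k z).
  elim: k => [_|k IH kn].
    by rewrite /bnum /bden !big_geq// mulr0 addr0 mul1r.
  rewrite /bnum /bden !big_nat_recr//= big_mkcond/= big_nat_recr//= -big_mkcond/=.
  rewrite -/(bnum th k z) -/(bden m th k z) dE -/(u k) !nsqM nsq_addr.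
  have := IH (ltnW kn); set S := \sum_(_ <= _ < _ | _) _; set X := nsq (bnum _ _ _).
  set Y := nsq (bden _ _ _ _) => XY.
  have S0 : 0 <= S by rewrite sumr_ge0.
  have X0 : 0 <= X by rewrite addr_ge0 ?sqr_ge0.
  have c0 : 0 <= 2 / (9 * s) by rewrite divr_ge0// mulr_ge0// ltW.
  have U0 : 0 <= nsq (u k) by rewrite addr_ge0 ?sqr_ge0.
  have mk := m0 k; have uk := u1 k.
  have T : (1 + 2 / (9 * s) * (if J k then m k else 0)) * nsq (u k) <=
      nsq (u k) + 2 * m k * complex.Re (u k) + m k ^+ 2.
    case: ifPn => [Jk|_]; last first.
      rewrite mulr0 addr0 mul1r -addrA lerDl addr_ge0 ?sqr_ge0// !mulr_ge0//.
      by rewrite (le_trans _ uk)// ltW.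
    have : nsq (u k) <= 9 * s ^+ 2.
      have -> : 9 * s ^+ 2 = (3 * s) ^+ 2 by ring.
      rewrite -sqr_normcE ler_pXn2r ?nnegrE ?normc_ge0//; last first.
        by rewrite mulr_ge0// ltW.
      rewrite (le_trans _ (hJ k kn Jk))//.
      have -> : u k = - (expi (- th k) * (z - expi (th k))).
        by rewrite mulrBr expiNM /u; ring.
      by rewrite normcN normcM normc_expi mul1r.
    move=> us.
    have : 2 / (9 * s) * m k * nsq (u k) <= 2 * m k * complex.Re (u k).
      have -> : 2 / (9 * s) * m k * nsq (u k) = 2 * m k * (nsq (u k) / (9 * s)).
        by field; rewrite gt_eqF.
      apply: ler_wpM2l; first by rewrite mulr_ge0.
      rewrite ler_pdivrMr ?mulr_gt0//; nra.
    by have := sqr_ge0 (m k); lra.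
  set v := (if J k then m k else 0) in T *.
  have v0 : 0 <= v by rewrite /v; case: ifP.
  set q := 2 / (9 * s) in XY c0 T *.
  apply: (@le_trans _ _ (((1 + q * S) * X) * ((1 + q * v) * nsq (u k)))).
    have -> : (1 + q * S) * X * ((1 + q * v) * nsq (u k)) =
       (1 + q * (S + v)) * (X * nsq (u k)) + q * S * (q * v) * (X * nsq (u k)).
      by ring.
    rewrite lerDl; apply: mulr_ge0 (mulr_ge0 X0 U0).
    exact: mulr_ge0 (mulr_ge0 c0 S0) (mulr_ge0 c0 v0).
  have qS := mulr_ge0 c0 S0; have qv := mulr_ge0 c0 v0.
  by apply: ler_pM => //; rewrite mulr_ge0// addr_ge0.
have := key n (leqnn n).
have X0 : 0 <= nsq (bnum th n z) by rewrite addr_ge0 ?sqr_ge0.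
have : 2 / 9 <= 2 / (9 * s) * \sum_(0 <= j < n | J j) m j.
  have -> : 2 / 9 = 2 / (9 * s) * s by field; rewrite gt_eqF.
  by rewrite ler_wpM2l// divr_ge0// mulr_ge0// ltW.
set S := _ * \sum_(_ <= _ < _ | _) _; nra.
Qed.

(** At the origin the barrier is the product of the 1 / (1 + m j), which is at least 1 minus the
    total mass. *)
Lemma barrier0_ge m th n : (forall j, 0 <= m j) ->
  \sum_(0 <= j < n) m j <= 20^-1 -> 19 / 20 <= normc (barrier m th n 0).
Proof.
move=> m0 hs.
have key k : (k <= n)%N -> 1 - \sum_(0 <= j < k) m j <= normc (barrier m th k 0).
  elim: k => [_|k IH kn]; first by rewrite /barrier !big_geq// normc1 subr0.
  rewrite /barrier !big_nat_recr//= normcM -/(barrier m th k 0).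
  have := IH (ltnW kn); set S := \sum_(_ <= _ < _) _; set X := normc (barrier _ _ _ _).
  move=> SX.
  have S0 : 0 <= S by rewrite sumr_ge0.
  have S1 : S <= 20^-1.
    apply: le_trans hs; rewrite (@big_cat_nat _ _ _ k 0 n)//= ?(ltnW kn)//.
    by rewrite lerDl sumr_ge0.
  rewrite !mulr0 !subr0 mul1r normcV.
  have -> : normc (1 + (m k)%:C : R[i]) = 1 + m k.
    by rewrite -[1]/(1%:C) -rmorphD normc_real ger0_norm// addr_ge0.
  rewrite ler_pdivlMr ?ltr_pwDl//; have := m0 k; nra.
apply: le_trans (key n (leqnn _)); lra.
Qed.

Lemma barrier_taylor2 m th n z : (forall j, 0 <= m j) -> normc z < 1 ->
  taylor2 (barrier m th n) z.
Proof.
move=> m0 z1; apply: taylor2_prod => j; apply: taylor2M.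
  apply: taylor2D; first exact: taylor2_cst.
  under eq_fun do rewrite -mulNr.
  by apply: taylor2M; [exact: taylor2_cst|exact: taylor2_id].
exact/taylor2_affineV/bden_factor_neq0.
Qed.

End barrier.

Section barrier_regularity.
Variable R : realType.
Implicit Types (z : R[i]) (n : nat) (m th : nat -> R).

Lemma nsq_barrier_le1 m th n z : (forall j, 0 <= m j) -> normc z < 1 ->
  nsq (barrier m th n z) <= 1.
Proof.
move=> m0 z1; rewrite -sqr_normcE expr_le1 ?normc_ge0//.
elim: n => [|n IH]; first by rewrite /barrier big_geq// normc1.
rewrite /barrier big_nat_recr//= normcM mulr_ile1 ?normc_ge0//.
rewrite normcM normcV ler_pdivrMr; last first.
  rewrite lt_def normc_ge0 andbT; apply/eqP => /eq0_normc/eqP.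
  by apply/negP; exact: bden_factor_neq0.
rewrite mul1r -(@ler_pXn2r _ 2) ?nnegrE ?normc_ge0// !sqr_normcE.
have -> : 1 + (m n)%:C - expi (- th n) * z = (1 - expi (- th n) * z) + (m n)%:C.
  by ring.
rewrite nsq_addr -addrA lerDl addr_ge0 ?sqr_ge0// !mulr_ge0//.
rewrite (le_trans _ (Re_oneB _))// normcM normc_expi mul1r subr_ge0.
exact: ltW.
Qed.

Lemma bnum_taylor2 th n z : taylor2 (bnum th n) z.
Proof.
apply: taylor2_prod => j; apply: taylor2D; first exact: taylor2_cst.
under eq_fun do rewrite -mulNr.
by apply: taylor2M; [exact: taylor2_cst|exact: taylor2_id].
Qed.

Lemma bden_taylor2 m th n z : taylor2 (bden m th n) z.
Proof.
apply: taylor2_prod => j; apply: taylor2D; first exact: taylor2_cst.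
under eq_fun do rewrite -mulNr.
by apply: taylor2M; [exact: taylor2_cst|exact: taylor2_id].
Qed.

Lemma trunc_taylor2 (c : nat -> R[i]) n z : taylor2 (trunc c n) z.
Proof.
apply: taylor2_sum => k; apply: taylor2M; first exact: taylor2_cst.
exact/taylor2X/taylor2_id.
Qed.

Lemma trunc0 (c : nat -> R[i]) n : trunc c n.+1 0 = c 0%N.
Proof.
rewrite /trunc big_nat_recl//= expr0 mulr1 big1 ?addr0// => k _.
by rewrite exprS mul0r mulr0.
Qed.

Lemma nsq_barrier m th n z :
  nsq (barrier m th n z) = nsq (bnum th n z) / nsq (bden m th n z).
Proof. by rewrite barrierE nsqM -!sqr_normcE normcV exprVn. Qed.

Lemma nsq_bden_gt0 m th n z : (forall j, 0 <= m j) -> normc z < 1 ->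
  0 < nsq (bden m th n z).
Proof.
move=> m0 z1; apply: nsq_gt0; rewrite /bden prodf_seq_neq0.
by apply/allP => j _ /=; exact: bden_factor_neq0.
Qed.

End barrier_regularity.

(** * Uniqueness of analytic series *)

Section uniqueness.
Variable R : realType.
Local Notation lambda := (@lebesgue_measure R).
Local Notation circle := (`[0, 2 * pi[%classic : set R).

Lemma pi2_gt0 : 0 < 2 * pi :> R.
Proof. by rewrite mulr_gt0// pi_gt0. Qed.

Lemma lambda_circle : lambda circle = (2 * pi)%:E.
Proof. by rewrite lebesgue_measure_itv/= lte_fin pi2_gt0 -EFinB subr0. Qed.

Definition node (n j : nat) : R := 2 * pi * j%:R / n%:R.

Definition cell (n j : nat) : set R := `[node n j, node n j.+1[%classic.

Lemma cell_exists n t : (0 < n)%N -> circle t -> exists2 j, (j < n)%N & cell n j t.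
Proof.
move=> n0 /=; rewrite in_itv/= => /andP[t0 tpi].
have n0' : 0 < n%:R :> R by rewrite ltr0n.
pose x := t * n%:R / (2 * pi).
have x0 : 0 <= x by apply: divr_ge0; [exact: mulr_ge0|exact: ltW pi2_gt0].
have := truncn_itv x0; set j := Num.truncn x => /andP[jx xj].
have tE : t = 2 * pi * x / n%:R.
  have := pi_gt0 R; rewrite /x; move: (@pi R) => p p0.
  by field; rewrite !gt_eqF.
exists j.
  rewrite -(ltr_nat R) (le_lt_trans jx)// /x ltr_pdivrMr ?pi2_gt0//.
  by rewrite mulrC ltr_pM2l.
rewrite /cell /node /= in_itv/= tE !ler_pM2r ?invr_gt0// ltr_pM2r ?invr_gt0//.
by rewrite ler_pM2l ?pi2_gt0// ltr_pM2l ?pi2_gt0// jx xj.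
Qed.

Lemma cell_triv n : (0 < n)%N -> trivIset setT (cell n).
Proof.
move=> n0; apply/trivIsetP => i j _ _ ij.
have n0' : 0 < n%:R :> R by rewrite ltr0n.
wlog lij : i j ij / (i < j)%N.
  move=> h; have [lij|lji|eij] := ltngtP i j; first exact: h.
    by rewrite setIC; apply: h => //; rewrite eq_sym.
  by move: ij; rewrite eij eqxx.
rewrite -subset0 => t; rewrite /cell /= !in_itv/= => -[/andP[_ a] /andP[b _]].
have : node n i.+1 <= node n j.
  by rewrite /node ler_pM2r ?invr_gt0// ler_pM2l ?pi2_gt0// ler_nat.
lra.
Qed.

(** The mass of a cell is the measure of the part of it outside [E]. An arc that misses [E] is
    covered by these parts of the cells it meets, so their masses add up to at least its length.
    Discretising in this way keeps the barrier a finite product. *)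
Lemma grid_masses (E : set R) (n : nat) (e : R) : (0 < n)%N -> measurable E ->
  (lambda (circle `\` E) <= e%:E)%E ->
  exists m : nat -> R, [/\ forall j, 0 <= m j, \sum_(0 <= j < n) m j <= e &
    forall a s : R, 0 <= a -> 0 <= s -> a + s <= 2 * pi ->
     (forall t, a <= t < a + s -> ~ E t) ->
     s <= \sum_(0 <= j < n |
             `[< exists2 t, a <= t < a + s & cell n j t >]) m j].
Proof.
move=> n0 mE hE.
pose B j := (circle `\` E) `&` cell n j.
have mB j : measurable (B j).
  by apply: measurableI; [exact: measurableD|exact: measurable_itv].
have Bfin j : lambda (B j) \is a fin_num.
  rewrite ge0_fin_numE//; apply: (@le_lt_trans _ _ (lambda circle)).
    apply: le_measure; first by apply/mem_set; exact: (mB j).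
      by apply/mem_set; exact: measurable_itv.
    by move=> t [[]].
  by rewrite lambda_circle ltry.
exists (fun j => fine (lambda (B j))); split.
- by move=> j; rewrite fine_ge0.
- rewrite -lee_fin; apply: le_trans hE.
  rewrite EFin_sum_fine//.
  rewrite big_mkord -measure_bigsetU//; last first.
    by apply: trivIset_setIl; exact: cell_triv.
  apply: le_measure.
  + by apply/mem_set; apply: bigsetU_measurable => j _; exact: mB.
  + by apply/mem_set; apply: measurableD.
  + by rewrite -bigcup_mkord; apply: bigcup_sub => j _ t [].
move=> a s a0 s0 aspi hEs.
rewrite -lee_fin EFin_sum_fine//.
pose J j := `[< exists2 t, a <= t < a + s & cell n j t >].
have -> : s%:E = lambda `[a, a + s[%classic.
  rewrite lebesgue_measure_itv/= lte_fin ltrDl -EFinB [a + s]addrC addrK.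
  by case: ltP => // s0'; congr (_%:E); apply/eqP; rewrite eq_le s0 s0'.
rewrite big_mkcond/=.
under eq_bigr => j _.
  rewrite (_ : (if _ then _ else _) = lambda (if J j then B j else set0)); last first.
    by rewrite /J; case: ifP; rewrite ?measure0.
  over.
rewrite big_mkord; apply: (@content_subadditive _ _ _ lambda `[a, a + s[%classic
  (fun j => if J j then B j else set0)).
- by move=> j _; case: ifP => _; [exact: mB|exact: measurable0].
- exact: measurable_itv.
- move=> t /=; rewrite in_itv/= => /andP[ta tas].
  have ct : circle t by rewrite /= in_itv/=; apply/andP; split; lra.
  have [j jn cj] := cell_exists n0 ct.
  apply: (@bigsetU_sup _ j n (fun j => if J j then B j else set0) jn).
  have -> : J j by apply/asboolP; exists t => //; rewrite ta tas.
  by split => //; split => //; apply: hEs; rewrite ta tas.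
Qed.

(** Where the barrier is not small, z lies in the Stolz region of a point of [E]. Otherwise an arc
    of length 1 - |z| next to the argument of z misses [E], and [bden_ge] bounds the squared barrier
    by 9/11, which is less than 5/6. *)
Lemma near_of_barrier (E : set R) n (m : nat -> R) (r : R) (z : R[i]) :
  (0 < n)%N -> (forall j, 0 <= m j) -> r < 1 -> 2 * pi / n%:R <= 1 - r ->
  (forall a s : R, 0 <= a -> 0 <= s -> a + s <= 2 * pi ->
     (forall t, a <= t < a + s -> ~ E t) ->
     s <= \sum_(0 <= j < n |
             `[< exists2 t, a <= t < a + s & cell n j t >]) m j) ->
  normc z <= r -> 5 * nsq (bden m (node n) n z) <= 6 * nsq (bnum (node n) n z) ->
  exists2 t, circle t /\ E t & normc (z - expi t) <= 2 * (1 - normc z).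
Proof.
move=> n0 m0 r1 nr hm zr hz; apply: contrapT => hE.
have z1 : normc z < 1 by exact: le_lt_trans r1.
have n0' : 0 < n%:R :> R by rewrite ltr0n.
set s := 1 - normc z.
have s0 : 0 < s by rewrite subr_gt0.
have sr : 1 - r <= s by rewrite lerD2l lerN2.
have s1 : s <= 1 by rewrite gerBl normc_ge0.
have pi2 : 2 <= pi :> R by exact: pi_ge2.
have [th] := polar z; rewrite in_itv/= => /andP[th0 th2] zE.
have zth : normc (z - expi th) = s.
  have -> : z - expi th = - (s%:C * expi th).
    by rewrite {1}zE /s rmorphB/= rmorph1; ring.
  by rewrite normcN normcM normc_expi mulr1 normc_real gtr0_norm.
(* The arc is laid on the side of [th] on which it does not wrap around 2pi, since [hm] speaks only
   of arcs inside [0, 2pi]; s <= 1 and pi >= 2 leave enough room. *)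
have [a [a0 as2 hth]] : exists a, [/\ 0 <= a, a + s <= 2 * pi & a <= th <= a + s].
  have [thpi|thpi] := leP th pi.
    by exists th; split => //; [lra|apply/andP; split; lra].
  by exists (th - s); split; [lra|lra|apply/andP; split; lra].
have near t : a <= t < a + s -> normc (z - expi t) <= 2 * s.
  move=> /andP[ta tas].
  have -> : z - expi t = (z - expi th) + (expi th - expi t) by ring.
  rewrite (le_trans (le_normcD _ _))// zth mulr_natl mulr2n lerD2l.
  by rewrite (le_trans (normc_expiB _ _))// ler_norml; apply/andP; split; lra.
have noE t : a <= t < a + s -> ~ E t.
  move=> ats Et; apply: hE; exists t; last exact: near.
  by split => //; rewrite /= in_itv/=; move: ats => /andP[? ?]; apply/andP; split; lra.
have hs := hm a s a0 (ltW s0) as2 noE.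
have := @bden_ge R m (node n) n z _ m0 z1 _ hs.
have hJ (j : nat) : (j < n)%N -> `[< exists2 t, a <= t < a + s & cell n j t >] ->
    normc (z - expi (node n j)) <= 3 * (1 - normc z).
  (* 2s for the distance to a point of the arc, and one more s because a cell is no longer than 1 -
     r <= s. *)
  move=> jn /asboolP[t ats]; rewrite /cell /= in_itv/= => /andP[tj tj1].
  have -> : z - expi (node n j) = (z - expi t) + (expi t - expi (node n j)) by ring.
  have -> : 3 * (1 - normc z) = 2 * s + s by rewrite /s; ring.
  rewrite (le_trans (le_normcD _ _))// lerD ?near//.
  rewrite (le_trans (normc_expiB _ _))//.
  have : node n j.+1 = node n j + 2 * pi / n%:R.
    by rewrite /node -natr1; move: (@pi R) => p; field; rewrite gt_eqF.
  by move=> nE; rewrite ler_norml; apply/andP; split; lra.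
move=> /(_ hJ).
have : 0 < nsq (bnum (node n) n z).
  rewrite nsq_gt0// /bnum prodf_seq_neq0; apply/allP => j _ /=; apply/eqP.
  move=> /(congr1 (@complex.Re R)).
  have := Re_oneB (expi (- node n j) * z); rewrite normcM normc_expi mul1r.
  by rewrite -/s => ? h; move: h => /= h; lra.
lra.
Qed.

End uniqueness.

Section analytic_uniqueness.
Variable R : realType.
Local Notation lambda := (@lebesgue_measure R).
Local Notation circle := (`[0, 2 * pi[%classic : set R).
Implicit Types (c : nat -> R[i]) (E : set R).

Lemma normc_psum_le c n t : normc (psum c n t) <= \sum_(0 <= k < n) normc (c k).
Proof.
rewrite /psum seriesEnat /= (le_trans (normc_sum _ _))//.
by apply: ler_sum => k _; rewrite normcM normc_expi mulr1.
Qed.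

Lemma compact_square (f g : R * R -> R) : continuous f -> continuous g ->
  compact [set p : R * R | [/\ `|p.1| <= 1, `|p.2| <= 1, f p <= 0 & g p <= 0]].
Proof.
move=> cf cg; apply: (@subclosed_compact _ _ (`[(-1 : R), 1] `*` `[(-1 : R), 1])).
- have -> : [set p : R * R | [/\ `|p.1| <= 1, `|p.2| <= 1, f p <= 0 & g p <= 0]] =
    ((`[(-1 : R), 1] `*` `[(-1 : R), 1]) `&` (f @^-1` [set x | x <= 0]))
    `&` (g @^-1` [set x | x <= 0]).
    apply/seteqP; split => [p [a b fp gp]|p [[[a b] fp] gp]].
      by split => //; split => //; split; rewrite /= in_itv/= -ler_norml.
    by move: a b; rewrite /= !in_itv/= -!ler_norml.
  apply: closedI; first apply: closedI.
  + by apply: compact_closed; [|apply: compact_setX; exact: segment_compact].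
  + by apply: closed_comp => [p _|]; [exact: cf|exact: closed_le].
  + by apply: closed_comp => [p _|]; [exact: cg|exact: closed_le].
- by apply: compact_setX; exact: segment_compact.
- by move=> p [a b _ _]; split; rewrite /= in_itv/= -ler_norml.
Qed.

Lemma exists_expr_lt (a b x y : R) : 0 < x -> 0 <= y -> y < x -> 0 < b ->
  exists K : nat, a * y ^+ K < b * x ^+ K.
Proof.
move=> x0 y0 yx b0.
have /cvgrPdist_lt/(_ b b0) [K _ /(_ K (leqnn K))] : geometric a (y / x) n @[n --> \oo] --> 0.
  by apply: cvg_geometric; rewrite ger0_norm ?divr_ge0 ?(ltW x0)// ltr_pdivrMr// mul1r.
rewrite /= sub0r normrN => h; exists K; rewrite -ltr_pdivrMr ?exprn_gt0//.
by rewrite (le_lt_trans _ h)// (le_trans _ (ler_norm _))// expr_div_n mulrA.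
Qed.

Theorem analytic_uniqueness c E : measurable E ->
  (lambda (circle `\` E) <= (20^-1)%:E)%E ->
  (forall e : R, 0 < e -> exists N, forall n t, (N <= n)%N -> circle t -> E t ->
     normc (psum c n t) <= e) ->
  c 0%N = 0.
Proof.
move=> mE hE cvgE; apply/eqP/negPn/negP => c00.
pose k := normc (c 0%N).
have k0 : 0 < k.
  by rewrite lt_def normc_ge0 andbT; apply: contra c00 => /eqP/eq0_normc ->.
have [M M0 hM] : exists2 M : R, 0 <= M &
    forall n t, circle t -> E t -> normc (psum c n t) <= M.
  have [N1 hN1] := cvgE 1 ltr01.
  exists (1 + \sum_(0 <= j < N1) normc (c j)).
    by rewrite addr_ge0// sumr_ge0// => j _; exact: normc_ge0.
  move=> n t ct Et; have [nN|Nn] := leqP N1 n.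
    rewrite (le_trans (hN1 _ _ nN ct Et))// lerDl sumr_ge0// => j _; exact: normc_ge0.
  rewrite (le_trans (normc_psum_le _ _ _))// ler_wpDl// [leRHS](@big_cat_nat _ _ _ n)//=.
    by rewrite lerDl sumr_ge0// => j _; exact: normc_ge0.
  exact: ltnW.
(* The constants are chosen in the order [K], [eta], [N], [r], [p]. The masses come last and depend
   on [p], but the bounds 5/6 and 361/400 on the squared barrier do not, so [K] can be fixed before
   them. *)
have [K hK] : exists K : nat, (9 * M ^+ 2) * (5 / 6) ^+ K < k ^+ 2 * (361 / 400) ^+ K.
  by apply: exists_expr_lt; [lra|lra|lra|exact: exprn_gt0].
pose eta := k * (19 / 20) ^+ K / 5.
have eta0 : 0 < eta by rewrite divr_gt0// mulr_gt0// exprn_gt0// divr_gt0.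
have hetaK : 16 * eta ^+ 2 < k ^+ 2 * (361 / 400) ^+ K.
  have -> : (361 / 400 : R) ^+ K = ((19 / 20) ^+ K) ^+ 2.
    by rewrite -exprM mulnC exprM; congr (_ ^+ _); field.
  have : 0 < (k * (19 / 20) ^+ K) ^+ 2.
    by rewrite exprn_gt0// mulr_gt0// exprn_gt0// divr_gt0.
  rewrite /eta; set x := (19 / 20) ^+ K; lra.
have [N hN] := cvgE eta eta0.
(* At least [N], as [trunc_le] requires, and positive, so that the truncation takes the value c 0 at
   the origin. *)
pose n := N.+1.
have D0 : 0 < 2 * N%:R * M + 1 by rewrite ltr_wpDl// !mulr_ge0.
pose dl := Num.min 2^-1 (eta / (2 * N%:R * M + 1)).
have dl0 : 0 < dl by rewrite /dl lt_min (divr_gt0 eta0 D0) invr_gt0 ltr0n.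
have dl1 : dl <= 2^-1 by rewrite /dl ge_min lexx.
have dlN : 2 * dl * N%:R * M <= eta.
  have : dl * (2 * N%:R * M + 1) <= eta by rewrite -ler_pdivlMr// /dl ge_min lexx orbT.
  lra.
pose r := 1 - dl.
have r1 : r < 1 by rewrite /r; lra.
have r0 : 0 < r by rewrite /r; lra.
pose p := (Num.truncn (2 * pi / dl)).+1.
have hp : 2 * pi / p%:R <= 1 - r.
  have -> : 1 - r = dl by rewrite /r; ring.
  rewrite ler_pdivrMr ?ltr0n// [leRHS]mulrC -ler_pdivrMr//.
  have := truncn_itv (ltW (divr_gt0 (pi2_gt0 R) dl0)) => /andP[_]; exact: ltW.
have [m [m0 ms hm]] := @grid_masses R E p 20^-1 isT mE hE.
pose B := barrier m (node R p) p.
pose Nn := bnum (node R p) p; pose Dd := bden m (node R p) p.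
pose f1 (q : R * R) := nsq (toC q) - r ^+ 2.
(* The condition |B|^2 >= 5/6 with denominators cleared: this form is continuous on the whole plane,
   whereas B has poles outside the open disc. The level 5/6 lies between 9/11, the bound over gaps,
   and 361/400, the bound at 0. *)
pose f2 (q : R * R) := 5 * nsq (Dd (toC q)) - 6 * nsq (Nn (toC q)).
have cf1 : continuous f1.
  move=> q; apply: cvgB; last exact: cvg_cst.
  exact: (taylor2_continuous (taylor2_id _)).
have cf2 : continuous f2.
  move=> q; apply: cvgB; apply: cvgM; try exact: cvg_cst.
    exact: (taylor2_continuous (bden_taylor2 _ _ _ _)).
  exact: (taylor2_continuous (bnum_taylor2 _ _ _)).
pose Q := [set q : R * R | [/\ `|q.1| <= 1, `|q.2| <= 1, f1 q <= 0 & f2 q <= 0]].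
have cQ : compact Q by exact: compact_square.
have Qr q : Q q -> normc (toC q) <= r.
  move=> [_ _ + _]; rewrite /f1 subr_le0 -sqr_normcE.
  by rewrite ler_pXn2r ?nnegrE ?normc_ge0// ltW.
have Q1 q : Q q -> normc (toC q) < 1 by move=> /Qr/le_lt_trans; apply.
pose G z := trunc c n z * B z ^+ K.
pose mb := Num.max (16 * eta ^+ 2) (9 * M ^+ 2 * (5 / 6) ^+ K).
have nsqB0 z : 0 <= nsq (B z) by rewrite addr_ge0 ?sqr_ge0.
have nsqGE z : nsq (G z) = nsq (trunc c n z) * nsq (B z) ^+ K.
  by rewrite /G nsqM -[nsq (B z ^+ K)]sqr_normcE normcX exprAC sqr_normcE.
have key : forall q, Q q -> nsq (G (toC q)) <= mb.
  apply: max_principle => //.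
  - move=> q /Q1 q1; rewrite -sqr_normcE expr_le1 ?normc_ge0//; exact: ltW.
  - move=> q /Q1 q1; apply: taylor2M; first exact: trunc_taylor2.
    exact/taylor2X/barrier_taylor2.
  move=> q Qq; have z1 := Q1 q Qq.
  have [q1 q2 q3 q4] := Qq.
  have [t [ct Et] zt] : exists2 t, circle t /\ E t &
      normc (toC q - expi t) <= 2 * (1 - normc (toC q)).
    apply: (@near_of_barrier R E p m r) => //; first exact: Qr.
    by move: q4; rewrite /f2 subr_le0.
  (* Three cases: on the circle of radius [r] the truncation is small and |B| <= 1; where |B|^2 =
     5/6 the truncation is at most 3M and B ^ K is small; every other point is interior to [Q]. *)
  have [e1|/eqP e1] := eqVneq (f1 q) 0.
    left; rewrite nsqGE le_max; apply/orP; left.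
    have zr : normc (toC q) = r.
      apply/eqP; rewrite -(@eqrXn2 _ 2) ?normc_ge0 ?(ltW r0)// sqr_normcE.
      by rewrite -subr_eq0 -/(f1 q) e1.
    have hP : normc (trunc c n (toC q)) <= 4 * eta.
      have := @trunc_le R c N n (toC q) t M eta (leqnSn N) (ltW eta0) z1
        (fun j => hM j t ct Et) (fun j Nj => hN j t Nj ct Et) zt.
      rewrite zr /r; move: dlN; lra.
    have -> : 16 * eta ^+ 2 = (4 * eta) ^+ 2 * 1 by ring.
    apply: ler_pM; rewrite ?exprn_ge0//; first by rewrite addr_ge0 ?sqr_ge0.
      by rewrite -sqr_normcE ler_pXn2r ?nnegrE ?normc_ge0// mulr_ge0// ltW.
    by rewrite exprn_ile1// nsq_barrier_le1.
  have [e2|/eqP e2] := eqVneq (f2 q) 0.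
    left; rewrite nsqGE le_max; apply/orP; right.
    have hP : normc (trunc c n (toC q)) <= 3 * M.
      have := @trunc_le R c 0 n (toC q) t M M (leq0n _) M0 z1
        (fun j => hM j t ct Et) (fun j _ => hM j t ct Et) zt.
      by rewrite mulr0 mul0r add0r.
    have -> : 9 * M ^+ 2 = (3 * M) ^+ 2 by ring.
    apply: ler_pM; rewrite ?exprn_ge0//; first by rewrite addr_ge0 ?sqr_ge0.
      by rewrite -sqr_normcE ler_pXn2r ?nnegrE ?normc_ge0// mulr_ge0.
    apply: lerXn2r; rewrite ?nnegrE//.
    have D1 := @nsq_bden_gt0 R m (node R p) p (toC q) m0 z1.
    rewrite /B nsq_barrier ler_pdivrMr//; move: e2; rewrite /f2 /Dd /Nn; lra.
  right.
  have l1 : f1 q < 0 by rewrite lt_neqAle q3 andbT; apply/eqP.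
  have l2 : f2 q < 0 by rewrite lt_neqAle q4 andbT; apply/eqP.
  have : \forall q' \near q, f1 q' < 0 /\ f2 q' < 0.
    near=> q'; split; near: q'.
      exact: (cvgr_lt (f1 q) (cf1 q)).
    exact: (cvgr_lt (f2 q) (cf2 q)).
  move=> /nbhs_ballP[e /= e0 he]; exists e => // q' hq1 hq2.
  have [g1 g2] : f1 q' < 0 /\ f2 q' < 0.
    by apply: he; split; rewrite -ball_normE /ball_/= distrC.
  have nq' : normc (toC q') <= 1.
    rewrite -(expr_le1 (n := 2)) ?normc_ge0// sqr_normcE.
    have : r ^+ 2 <= 1 by rewrite expr_le1// ltW.
    move: g1; rewrite /f1; lra.
  split; [| |exact: ltW|exact: ltW].
    exact: le_trans (normc_Re (toC q')) nq'.
  exact: le_trans (normc_Im (toC q')) nq'.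
have b0 : 361 / 400 <= nsq (B 0).
  have := @barrier0_ge R m (node R p) p m0 ms; rewrite -/B => h.
  rewrite -sqr_normcE (_ : 361 / 400 = (19 / 20) ^+ 2); last by field.
  by rewrite ler_pXn2r ?nnegrE ?normc_ge0// divr_ge0.
have Q0 : Q (0, 0).
  have nsq0 : nsq (0 : R[i]) = 0 by rewrite /nsq /= expr0n addr0.
  split; rewrite /= ?normr0//.
    by rewrite /f1 -[toC _]/(0 : R[i]) nsq0 sub0r oppr_le0 sqr_ge0.
  have D1 : 0 < nsq (Dd 0) by apply: nsq_bden_gt0; rewrite ?normc0.
  move: b0; rewrite /B nsq_barrier ler_pdivlMr// /f2 -[toC _]/(0 : R[i]) -/Nn -/Dd; lra.
have := key _ Q0; rewrite nsqGE -[toC _]/(0 : R[i]) trunc0 -sqr_normcE -/k.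
apply/negP; rewrite -ltNge gt_max.
have : k ^+ 2 * (361 / 400) ^+ K <= k ^+ 2 * nsq (B 0) ^+ K.
  apply: ler_wpM2l; first exact: sqr_ge0.
  by apply: lerXn2r => //; rewrite nnegrE; [lra|exact: nsqB0].
by move=> h; rewrite (lt_le_trans hetaK h) (lt_le_trans hK h).
Unshelve. all: by end_near. Qed.

End analytic_uniqueness.

(** * Almost uniform convergence and linear functions *)

Section exceptional_sets.
Variable R : realType.
Local Notation lambda := (@lebesgue_measure R).
Local Notation circle := (`[0, 2 * pi[%classic : set R).
Implicit Types (c : nat -> R[i]) (f : R -> R[i]).

(** Continuity relative to the half-open interval: the paths are not controlled at negative
    times. *)
Definition cont_on f := forall t, circle t -> forall e : R, 0 < e ->
  exists2 d : R, 0 < d & forall u, circle u -> `|u - t| < d -> normc (f u - f t) < e.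

Definition bad c f (n : nat) (e : R) : set R :=
  [set t | circle t /\ exists2 i, (n <= i)%N & e < normc (psum c i t - f t)].

Definition badm c f (n m : nat) (e : R) : set R :=
  [set t | circle t /\ exists2 i, (n <= i <= m)%N & e < normc (psum c i t - f t)].

Lemma badE c f n e : bad c f n e = \bigcup_m badm c f n m e.
Proof.
apply/seteqP; split => [t [ct [i ni h]]|t [m _ [ct [i /andP[ni _] h]]]].
  by exists i => //; split => //; exists i => //; rewrite ni leqnn.
by split => //; exists i.
Qed.

Lemma psum_lipschitz c n t u :
  normc (psum c n u - psum c n t) <= (\sum_(0 <= k < n) normc (c k) * k%:R) * `|u - t|.
Proof.
rewrite /psum !seriesEnat /= -sumrB (le_trans (normc_sum _ _))// mulr_suml.
apply: ler_sum => k _; rewrite -mulrBr normcM -mulrA ler_wpM2l ?normc_ge0//.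
by rewrite (le_trans (normc_expiB _ _))// -mulrBr normrM normr_nat.
Qed.

Lemma cont_on_psumB c f n : cont_on f -> forall t, circle t -> forall e : R, 0 < e ->
  exists2 d : R, 0 < d & forall u, circle u -> `|u - t| < d ->
    `|normc (psum c n u - f u) - normc (psum c n t - f t)| < e.
Proof.
move=> cf t ct e e0; have e20 : 0 < e / 2 by rewrite divr_gt0.
have [d d0 hd] := cf t ct _ e20.
set L := \sum_(0 <= k < n) normc (c k) * k%:R.
have L0 : 0 <= L by rewrite sumr_ge0// => k _; rewrite mulr_ge0 ?normc_ge0.
have L1 : 0 < L + 1 by rewrite ltr_wpDl.
exists (Num.min d (e / 2 / (L + 1))); first by rewrite lt_min d0 divr_gt0.
move=> u cu; rewrite lt_min ltr_pdivlMr// => /andP[ud uL].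
have hu := hd u cu ud.
have hL : normc (psum c n u - psum c n t) < e / 2.
  rewrite (le_lt_trans (psum_lipschitz _ _ _ _))// -/L (le_lt_trans _ uL)//.
  by rewrite mulrC ler_wpM2l// lerDl.
have := le_normcB (psum c n u - f u) (psum c n t - f t).
have := le_normcB (psum c n t - f t) (psum c n u - f u).
rewrite [X in _ <= X -> _]normcB => h1 h2.
have : normc (psum c n u - f u - (psum c n t - f t)) < e.
  have -> : psum c n u - f u - (psum c n t - f t) =
    (psum c n u - psum c n t) + - (f u - f t) by ring.
  by rewrite (le_lt_trans (le_normcD _ _))// normcN; lra.
by move=> h; rewrite ltr_norml; apply/andP; split; lra.
Qed.

Lemma node_circle n i : (i < n)%N -> circle (node R n i).
Proof.
move=> ltin; have n0 : 0 < n%:R :> R by rewrite ltr0n (leq_ltn_trans _ ltin).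
rewrite /= in_itv/= /node divr_ge0 ?mulr_ge0 ?pi_ge0//=.
by rewrite ltr_pdivrMr// ltr_pM2l ?pi2_gt0// ltr_nat.
Qed.

Lemma dyadic_dense t (e : R) : circle t -> 0 < e ->
  exists l i, (i < 2 ^ l)%N /\ `|node R (2 ^ l) i - t| < e.
Proof.
move=> ct e0; pose l := (Num.truncn (2 * pi / e)).+1.
have l2 : (0 < 2 ^ l)%N by rewrite expn_gt0.
have l2R : 0 < (2 ^ l)%:R :> R by rewrite ltr0n.
have [i il] := cell_exists l2 ct; rewrite /cell /= in_itv/= => /andP[h1 h2].
exists l, i; split => //.
have : node R (2 ^ l) i.+1 = node R (2 ^ l) i + 2 * pi / (2 ^ l)%:R.
  by rewrite /node -natr1; move: (@pi R) => p; field; rewrite gt_eqF.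
have : 2 * pi / (2 ^ l)%:R < e.
  rewrite ltr_pdivrMr// [ltRHS]mulrC -ltr_pdivrMr//.
  have := truncn_itv (ltW (divr_gt0 (pi2_gt0 R) e0)) => /andP[_ h].
  rewrite (lt_trans h)// ltr_nat; exact: ltn_expl.
by move=> a b; rewrite ltr_norml; apply/andP; split; lra.
Qed.

Section family.
Context d (S : measurableType d) (f : S -> R -> R[i]).
Hypothesis cont_f : forall s, cont_on (f s).
Hypothesis mRe : forall l i, (i < 2 ^ l)%N ->
  measurable_fun setT (fun s => complex.Re (f s (node R (2 ^ l) i))).
Hypothesis mIm : forall l i, (i < 2 ^ l)%N ->
  measurable_fun setT (fun s => complex.Im (f s (node R (2 ^ l) i))).

Lemma measurable_dist_node c n l i : (i < 2 ^ l)%N ->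
  measurable_fun setT (fun s => normc (psum c n (node R (2 ^ l) i) - f s (node R (2 ^ l) i))).
Proof.
move=> il; set t := node R (2 ^ l) i; set z := psum c n t.
have -> : (fun s => normc (z - f s t)) = (@Num.sqrt R) \o (fun s =>
    (complex.Re z - complex.Re (f s t)) ^+ 2 + (complex.Im z - complex.Im (f s t)) ^+ 2).
  by apply/funext => s /=; case: z => a b; case: (f s t) => a' b'.
apply: measurableT_comp.
  by apply: continuous_measurable_fun; exact: sqrt_continuous.
apply: measurable_funD; apply: measurable_funX; apply: measurable_funB => //.
  exact: mRe.
exact: mIm.
Qed.

(** Joint measurability of a function that is continuous in t and measurable in s at each dyadic
    node. Only dyadic times enter, because the past and future sigma-algebras of the Brownian motion
    are generated by such times. *)
Lemma measurable_exceed c n (e : R) : measurable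
  [set st : S * R | circle st.2 /\ e < normc (psum c n st.2 - f st.1 st.2)].
Proof.
pose g s t := normc (psum c n t - f s t).
(* The set is a countable union of rectangles: a rational interval on whose dyadic nodes the bound
   is exceeded by a fixed margin. The margin keeps the inequality strict when continuity extends it
   from the nodes to the whole interval. *)
pose A (x : rat * rat * nat) : set S := [set s | forall l i, (i < 2 ^ l)%N ->
  ratr x.1.1 < node R (2 ^ l) i < ratr x.1.2 ->
  e + x.2.+1%:R^-1 <= g s (node R (2 ^ l) i)].
pose B (x : rat * rat * nat) : set R := circle `&` `]ratr x.1.1, ratr x.1.2[.
have -> : [set st : S * R | circle st.2 /\ e < normc (psum c n st.2 - f st.1 st.2)] =
    \bigcup_x (A x `*` B x).
  apply/seteqP; split => [[s t] /= [ct est]|[s t] [[[p q] k] _ [/= Ax [ct]]]].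
    have gap : 0 < (g s t - e) / 2 by rewrite divr_gt0// subr_gt0.
    have [dl dl0 hdl] := cont_on_psumB c n (cont_f s) ct gap.
    have [p /andP[p1 p2]] : exists p : rat, t - dl < ratr p < t.
      by have [p hp] := @rat_in_itvoo R (t - dl) t ltac:(lra); exists p; rewrite in_itv in hp.
    have [q /andP[q1 q2]] : exists q : rat, t < ratr q < t + dl.
      by have [q hq] := @rat_in_itvoo R t (t + dl) ltac:(lra); exists q; rewrite in_itv in hq.
    pose k := Num.truncn ((g s t - e) / 2)^-1.
    exists (p, q, k) => //; split => /=; last by split => //; rewrite /= in_itv/= p2 q1.
    move=> l i il /= /andP[pl lq].
    have k1 : k.+1%:R^-1 < (g s t - e) / 2.
      rewrite invf_plt ?posrE ?ltr0n//.
      by have /andP[] := truncn_itv (ltW (eqbRL (@invr_gt0 _ _) gap)).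
    have := hdl (node R (2 ^ l) i) (node_circle il)
      ltac:(rewrite ltr_norml; apply/andP; split; lra).
    rewrite ltr_norml -/(g s _) -/(g s t) => /andP[h _].
    move: k1 h; move: (k.+1%:R^-1) (g s (node R (2 ^ l) i)) (g s t) => y u v; lra.
  rewrite /= in_itv/= => /andP[pt tq]; split => //; apply: contrapT => /negP; rewrite -leNgt => gte.
  have k0 : 0 < k.+1%:R^-1 :> R by rewrite invr_gt0 ltr0n.
  have [dl dl0 hdl] := cont_on_psumB c n (cont_f s) ct k0.
  pose e' := Num.min dl (Num.min (t - ratr p) (ratr q - t)).
  have e'0 : 0 < e' by rewrite /e' !lt_min dl0 !subr_gt0 pt.
  have [l [i [il]]] := dyadic_dense ct e'0.
  rewrite /e' !lt_min => /andP[h1 /andP[h2 h3]].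
  have := Ax l i il; have := hdl _ (node_circle il) h1.
  rewrite !ltr_norml -/(g s _) -/(g s t) => /andP[_ h4] /=.
  move: h2 h3; rewrite !ltr_norml => /andP[h2 h2'] /andP[h3 h3'].
  have -> : ratr p < node R (2 ^ l) i < ratr q by apply/andP; split; lra.
  move=> /(_ isT); move: h4 gte; rewrite -/(g s t).
  move: (k.+1%:R^-1) (g s (node R (2 ^ l) i)) (g s t) => y u v; lra.
apply: countable_bigcupT_measurable => [|x]; first exact: countableP.
apply: measurableX; last by apply: measurableI; exact: measurable_itv.
have -> : A x = \bigcap_l \bigcap_i [set s | (i < 2 ^ l)%N ->
  ratr x.1.1 < node R (2 ^ l) i < ratr x.1.2 ->
  e + x.2.+1%:R^-1 <= g s (node R (2 ^ l) i)].
  apply/seteqP; split => [s As l _ i _|s As l i]; first exact: As.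
  exact: (As l I i I).
apply: bigcapT_measurable => l; apply: bigcapT_measurable => i.
have [il|_] := boolP (i < 2 ^ l)%N; last by rewrite (_ : [set _ | _] = setT)//; apply/seteqP; split.
have [pq|_] := boolP (ratr x.1.1 < node R (2 ^ l) i < ratr x.1.2); last first.
  by rewrite (_ : [set _ | _] = setT)//; apply/seteqP; split => // s _ _.
have -> : [set s | true -> true -> e + x.2.+1%:R^-1 <= g s (node R (2 ^ l) i)] =
    (fun s => g s (node R (2 ^ l) i)) @^-1` `[e + x.2.+1%:R^-1, +oo[.
  apply/seteqP; split => s; rewrite /= in_itv/= andbT; first by apply.
  by move=> ? _ _.
rewrite -[X in measurable X]setTI; apply: measurable_dist_node => //.
Qed.

Lemma measurable_badm_graph c n m e : measurable
  [set st : S * R | badm c (f st.1) n m e st.2].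
Proof.
have -> : [set st : S * R | badm c (f st.1) n m e st.2] =
  \bigcup_(i in [set i | (n <= i <= m)%N])
     [set st : S * R | circle st.2 /\ e < normc (psum c i st.2 - f st.1 st.2)].
  apply/seteqP; split => [[s t] [ct [i im h]]|[s t] [i im [ct h]]]; first by exists i.
  by split => //; exists i.
by apply: bigcup_measurable => i _; exact: measurable_exceed.
Qed.

Lemma measurable_badm_le c n m e b :
  measurable [set s | (lambda (badm c (f s) n m e) <= b)%E].
Proof.
have mx := measurable_fun_xsection (lambda : {sigma_finite_measure set _ -> \bar R})
  (measurable_badm_graph c n m e).
have -> : [set s | (lambda (badm c (f s) n m e) <= b)%E] = setT `&`
   ((lambda \o xsection [set st : S * R | badm c (f st.1) n m e st.2]) @^-1` [set x | (x <= b)%E]).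
  rewrite setTI; apply/seteqP.
  have -> : (lambda \o xsection [set st : S * R | badm c (f st.1) n m e st.2]) =
    (fun s => lambda (badm c (f s) n m e)).
    apply/funext => s /=; congr (lambda _); apply/seteqP.
    by split => t; rewrite /xsection/= inE.
  by split.
apply: mx => //.
have -> : [set x : \bar R | (x <= b)%E] = [set` `]-oo, b]%O].
  by apply/seteqP; split => x; rewrite /= in_itv.
exact: emeasurable_itv.
Qed.

End family.

Lemma measurable_badm c f n m e : cont_on f -> measurable (badm c f n m e).
Proof.
move=> cf.
have := @measurable_xsection _ _ (measurableTypeR R) (measurableTypeR R) _ 0
  (@measurable_badm_graph _ (measurableTypeR R) (fun=> f) (fun=> cf)
   (fun _ _ _ => measurable_cst _) (fun _ _ _ => measurable_cst _) c n m e).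
congr measurable; apply/seteqP.
by split => t; rewrite /xsection/= inE.
Qed.

Lemma measurable_bad c f n e : cont_on f -> measurable (bad c f n e).
Proof.
by move=> cf; rewrite badE; apply: bigcupT_measurable => m; exact: measurable_badm.
Qed.

End exceptional_sets.

Section linear_fibre.
Variable R : realType.
Local Notation lambda := (@lebesgue_measure R).
Local Notation circle := (`[0, 2 * pi[%classic : set R).
Implicit Types (c : nat -> R[i]) (f : R -> R[i]).

Lemma lebesgue_measure_shift (a : R) (A : set (measurableTypeR R)) : measurable A ->
  lambda ((fun t => t + a) @^-1` A) = lambda A.
Proof.
move=> mA.
have mf : measurable_fun setT ((fun t => t + a) : measurableTypeR R -> measurableTypeR R).
  by apply: continuous_measurable_fun => t; apply: cvgD; [exact: cvg_id|exact: cvg_cst].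
pose mu := [the measure _ _ of
  pushforward lambda (fun t : measurableTypeR R => t + a : measurableTypeR R)].
apply/esym; apply: (lebesgue_measure_unique (mu := mu mf)) => // X [[x y] _ <-].
rewrite /mu /= /pushforward.
have -> : (fun t => t + a) @^-1` `]x, y]%classic = `]x - a, y - a]%classic.
  by apply/seteqP; split => t /=; rewrite !in_itv/= ltrBlDr lerBrDr.
rewrite !lebesgue_measure_itv/= !lte_fin ltrD2r; case: ifP => // _.
by congr (_%:E); ring.
Qed.

Lemma measure_bigcup_half d (T : measurableType d) (mu : {measure set T -> \bar R})
    (F : nat -> set T) (e : R) : 0 <= e -> (forall j, measurable (F j)) ->
  (forall j, (mu (F j) <= (e / 2 ^+ j.+1)%:E)%E) -> (mu (\bigcup_j F j) <= e%:E)%E.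
Proof.
move=> e0 mF hF.
apply: (@le_trans _ _ (\sum_(j <oo) mu (F j))%E).
  by apply: measure_sigma_subadditive => //; exact: bigcupT_measurable.
apply: le_trans (epsilon_trick0 xpredT e0); apply: lee_nneseries => // j _.
by rewrite natrX.
Qed.

(** Egorov's conclusion with the rate [N] made explicit. No almost everywhere statement remains, so
    the condition survives a limit in the coefficients. *)
Definition almost_unif c f (N : nat -> nat) :=
  forall j, (lambda (bad c f (N j) (2 / 2 ^+ j)) <= (1 / 2 ^+ j)%:E)%E.

Lemma linear_fibre f1 f2 c1 c2 N1 N2 (rho : R[i]) :
  cont_on f1 -> cont_on f2 -> almost_unif c1 f1 N1 -> almost_unif c2 f2 N2 ->
  (forall t, 0 <= t <= 2 * pi * (1 - 512^-1) -> f1 t - f2 t = t%:C * rho) ->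
  rho = 0.
Proof.
move=> cf1 cf2 h1 h2 hlin.
pose al : R := 2 * pi / 512.
have pi0 := pi_gt0 R.
have pi4 : pi <= 4 :> R by have [/andP[_]] := pihalf_02_cos_pihalf R; lra.
have al0 : 0 < al by rewrite /al; lra.
(* The shift by 10 makes the union of all exceptional sets have measure at most 4 / 2^10. *)
pose Bd j := bad c1 f1 (N1 (j + 10)%N) (2 / 2 ^+ (j + 10)) `|`
             bad c2 f2 (N2 (j + 10)%N) (2 / 2 ^+ (j + 10)).
have mBd j : measurable (Bd j) by apply: measurableU; exact: measurable_bad.
pose U := \bigcup_j Bd j.
have mU : measurable U by exact: bigcupT_measurable.
have hU : (lambda U <= (4 / 2 ^+ 10)%:E)%E.
  apply: measure_bigcup_half => // j.
  apply: (le_trans (measureU2 _ _ _)); try exact: measurable_bad.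
  apply: (le_trans (leeD (h1 _) (h2 _))).
  rewrite -EFinD lee_fin exprD [2 ^+ j.+1]exprS.
  have : 0 < 2 ^+ j :> R by rewrite exprn_gt0.
  by move=> ?; rewrite le_eqVlt; apply/orP; left; apply/eqP; field; rewrite gt_eqF.
have mV : measurable ((fun t => t + al) @^-1` U).
  have : measurable_fun setT ((fun t => t + al) : measurableTypeR R -> measurableTypeR R).
    by apply: continuous_measurable_fun => t; apply: cvgD; [exact: cvg_id|exact: cvg_cst].
  by move=> mf; rewrite -[X in measurable X]setTI; exact: mf.
(* Removing [I] keeps both t and t + [al] in the range of [hlin], with no wrapping around 2pi. Its
   length is 2 [al]; with pi <= 4 the removed sets total at most 1/32 + 1/128, below 1/20. *)
pose I := `[2 * pi * (1 - 512^-1) - al, 2 * pi[%classic : set R.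
have mI : measurable I by exact: measurable_itv.
pose E := circle `\` (I `|` (U `|` (fun t => t + al) @^-1` U)).
have mX : measurable (I `|` (U `|` (fun t => t + al) @^-1` U)).
  by apply: measurableU => //; exact: measurableU.
have mE : measurable E by apply: measurableD => //; exact: measurable_itv.
have hE : (lambda (circle `\` E) <= (20^-1)%:E)%E.
  apply: (@le_trans _ _ (lambda (I `|` (U `|` (fun t => t + al) @^-1` U)))).
    apply: le_measure.
    - by apply/mem_set; apply: measurableD => //; exact: measurable_itv.
    - exact/mem_set.
    - by move=> t [ct]; rewrite /E => /not_andP[//|/contrapT].
  apply: (le_trans (measureU2 _ _ _)) => //; first exact: measurableU.
  have hI : (lambda I <= (2 * al)%:E)%E.
    rewrite lebesgue_measure_itv/= lte_fin ifT; last by rewrite /al; lra.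
    by rewrite -EFinB lee_fin /al; lra.
  have hV := lebesgue_measure_shift al mU.
  apply: (@le_trans _ _ ((2 * al)%:E + ((4 / 2 ^+ 10)%:E + (4 / 2 ^+ 10)%:E))%E).
    apply: leeD; first exact: hI.
    apply: (le_trans (measureU2 _ _ _)) => //.
    by apply: leeD; [exact: hU|rewrite -hV in hU; exact: hU].
  rewrite -!EFinD lee_fin /al (_ : 2 ^+ 10 = 1024); last by ring.
  lra.
(* The coefficients of the translated difference minus itself, with the limit [al] rho subtracted
   from the zeroth one. That coefficient equals - [al] rho, so its vanishing gives the claim. *)
pose c n := (c1 n - c2 n) * (expi (n%:R * al) - 1) - (if n is 0%N then al%:C * rho else 0).
have cE n t : (0 < n)%N -> psum c n t =
   (psum c1 n (t + al) - psum c2 n (t + al)) - (psum c1 n t - psum c2 n t) - al%:C * rho.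
  case: n => // n _; elim: n => [|n IH].
    by rewrite !psumS !psum0 /c !mul0r !expi0; ring.
  have eD : expi (n.+1%:R * (t + al)) = expi (n.+1%:R * t) * expi (n.+1%:R * al).
    by rewrite mulrDr expiD.
  by rewrite psumS IH !(psumS _ n.+1) eD /c subr0; ring.
have c0 : c 0%N = 0.
  apply: (analytic_uniqueness mE hE) => e e0.
  have [j hj] : exists j : nat, 8 / 2 ^+ (j + 10) <= e.
    pose j := (Num.truncn (8 / e)).+1; exists j.
    rewrite ler_pdivrMr ?exprn_gt0// mulrC -ler_pdivrMr//.
    have /andP[_ h] := truncn_itv (ltW (divr_gt0 (ltr0n R 8) e0)).
    rewrite (le_trans (ltW h))// -natrX ler_nat (@leq_trans (2 ^ j))//.
      by rewrite ltnW// ltn_expl.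
    by rewrite leq_exp2l// leq_addr.
  (* At least 1, because the empty partial sum does not yet contain the subtracted constant. *)
  exists (maxn 1 (maxn (N1 (j + 10)%N) (N2 (j + 10)%N))) => n t.
  rewrite !geq_max => /andP[n0 /andP[n1 n2]] ct [_ Et].
  have [nI nU nV] : [/\ ~ I t, ~ U t & ~ U (t + al)].
    by split => h; apply: Et; [left|right; left|right; right].
  move: (ct); rewrite /= in_itv/= => /andP[t0 t2pi].
  have tI : t < 2 * pi * (1 - 512^-1) - al.
    by rewrite ltNge; apply/negP => h; apply: nI; rewrite /I /= in_itv/= h.
  have ct' : circle (t + al).
    rewrite /= in_itv/=; apply/andP; split; first by lra.
    by move: tI; lra.
  have good u : circle u -> ~ U u ->
      normc (psum c1 n u - f1 u) <= 2 / 2 ^+ (j + 10) /\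
      normc (psum c2 n u - f2 u) <= 2 / 2 ^+ (j + 10).
    move=> cu nUu; split; rewrite leNgt; apply/negP => h; apply: nUu; exists j => //.
      by left; split => //; exists n.
    by right; split => //; exists n.
  have [g1 g2] := good _ ct nU; have [g3 g4] := good _ ct' nV.
  have l1 : f1 t - f2 t = t%:C * rho by apply: hlin; apply/andP; split; lra.
  have l2 : f1 (t + al) - f2 (t + al) = (t + al)%:C * rho.
    by apply: hlin; apply/andP; split; lra.
  have -> : psum c n t = (psum c1 n (t + al) - f1 (t + al)) +
     - (psum c2 n (t + al) - f2 (t + al)) + - (psum c1 n t - f1 t)
     + (psum c2 n t - f2 t).
    rewrite cE//.
    have -> : al%:C * rho = (f1 (t + al) - f2 (t + al)) - (f1 t - f2 t).
      by rewrite l1 l2 rmorphD/=; ring.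
    by ring.
  apply: le_trans hj.
  have -> : 8 / 2 ^+ (j + 10) = 2 / 2 ^+ (j + 10) + 2 / 2 ^+ (j + 10)
     + 2 / 2 ^+ (j + 10) + 2 / 2 ^+ (j + 10) :> R by ring.
  by do 3! (apply: le_trans (le_normcD _ _) _; apply: lerD; rewrite ?normcN//).
have : al%:C * rho = 0.
  by move: c0; rewrite /c mul0r expi0 subrr mulr0 sub0r => /eqP; rewrite oppr_eq0 => /eqP.
move/eqP; rewrite mulf_eq0 => /orP[/eqP/(congr1 (@complex.Re R))/= al0'|/eqP//].
by move: al0; rewrite al0' ltxx.
Qed.

End linear_fibre.

(** * Capacitability *)

Section capacity.
Variable R : realType.
Local Notation lambda := (@lebesgue_measure R).
Local Notation circle := (`[0, 2 * pi[%classic : set R).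
Implicit Types (c : nat -> R[i]) (f : R -> R[i]) (N : nat -> nat).

Definition represents c f := {ae lambda, forall t, t \in `[0, 2 * pi[ ->
  series (fun n => c n * expi (n%:R * t)) @ \oo --> f t}.

(** Egorov's theorem: the sets [bad] decrease in n inside a set of finite measure, and their
    intersection lies in the null set of divergence. *)
Lemma represents_bad c f (e b : R) : cont_on f -> represents c f -> 0 < e -> 0 < b ->
  exists n, forall m, (n <= m)%N -> (lambda (bad c f m e) <= b%:E)%E.
Proof.
move=> cf [Z [mZ Z0 hZ]] e0 b0.
have mB n : measurable (bad c f n e) by exact: measurable_bad.
have mI : measurable (\bigcap_n bad c f n e) by exact: bigcapT_measurable.
have mono : {homo (bad c f ^~ e) : n m / (n <= m)%N >-> (m <= n)%O}.
  move=> n m nm; apply/subsetPset => t [ct [i mi h]]; split => //.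
  by exists i => //; exact: leq_trans mi.
have I0 : lambda (\bigcap_n bad c f n e) = 0%E.
  apply/eqP; rewrite eq_le measure_ge0 andbT -Z0; apply: le_measure.
  - exact/mem_set.
  - exact/mem_set.
  - apply: subset_trans hZ => t ht /= hcv.
    have [ct _] := ht 0%N I.
    have := hcv ct => /cvgrPdist_lt/(_ e%:C); rewrite ltcR => /(_ e0) [n _ hn].
    have [_ [i ni]] := ht n I; apply/negP; rewrite -leNgt ltW//.
    by have := hn i ni; rewrite /= distrC -ltcR.
have : (lambda (bad c f n e)) @[n --> \oo] --> 0%E.
  rewrite -I0; apply: nonincreasing_cvg_mu => //.
  apply: (@le_lt_trans _ _ (lambda circle)).
    apply: le_measure; [by apply/mem_set; exact: mB|by apply/mem_set; exact: measurable_itv|].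
    by move=> t [].
  by rewrite lambda_circle ltry.
move=> /fine_cvgP[_ /cvgrPdist_lt/(_ b b0)[n _ hn]]; exists n => m nm.
have := hn m nm; rewrite /= sub0r normrN => h.
rewrite -[leLHS]fineK ?lee_fin; first by rewrite (le_trans (ler_norm _))// ltW.
rewrite ge0_fin_numE//; apply: (@le_lt_trans _ _ (lambda circle)).
  apply: le_measure; [by apply/mem_set; exact: mB|by apply/mem_set; exact: measurable_itv|].
  by move=> t [].
by rewrite lambda_circle ltry.
Qed.

Definition rat_coef (q : seq (rat * rat)) (i : nat) : R[i] :=
  ratr (nth (0, 0) q i).1 +i* ratr (nth (0, 0) q i).2.

(** Rational coefficients turn the existential quantifier into a countable union, hence a measurable
    condition. The sequence [N] both bounds the coefficients, which supplies compactness, and gives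
    the rate of convergence. *)
Definition level N k f := exists q, forall j, (j < k)%N ->
  [/\ `|complex.Re (rat_coef q j)| <= (N j).+1%:R,
      `|complex.Im (rat_coef q j)| <= (N j).+1%:R &
      (lambda (badm (rat_coef q) f (N j) k (1 / 2 ^+ j)) <= (1 / 2 ^+ j)%:E)%E].

Definition prelevel (l : seq nat) f := exists c, represents c f /\ forall j, (j < size l)%N ->
  [/\ `|complex.Re (c j)| <= (nth 0%N l j)%:R,
      `|complex.Im (c j)| <= (nth 0%N l j)%:R &
      (lambda (bad c f (nth 0%N l j) (2^-1 / 2 ^+ j)) <= (1 / 2 ^+ j)%:E)%E].

(** Every sufficiently large next term is admissible, for the same witness c: this is the monotone
    structure of the Souslin scheme. *)
Lemma prelevel_rcons l f : cont_on f -> prelevel l f ->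
  exists n, forall m, (n <= m)%N -> prelevel (rcons l m) f.
Proof.
move=> cf [c [rc hc]]; set j := size l.
have [||n hn] := @represents_bad c f (2^-1 / 2 ^+ j) (1 / 2 ^+ j) cf rc.
- by rewrite divr_gt0// ?exprn_gt0// invr_gt0 ltr0n.
- by rewrite divr_gt0// exprn_gt0.
pose x := Num.max `|complex.Re (c j)| `|complex.Im (c j)|.
exists (maxn n (Num.truncn x).+1) => m; rewrite geq_max => /andP[nm xm].
exists c; split => // i; rewrite size_rcons ltnS leq_eqVlt => /orP[/eqP ->|il].
  have xm' : x <= m%:R.
    have x0 : 0 <= x by rewrite le_max normr_ge0.
    have /andP[_ h] := truncn_itv x0; rewrite (le_trans (ltW h))// ler_nat//.
  rewrite nth_rcons ltnn eqxx; split; last exact: hn.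
    by rewrite (le_trans _ xm')// le_max lexx.
  by rewrite (le_trans _ xm')// le_max lexx orbT.
by rewrite nth_rcons il; exact: hc.
Qed.

Lemma normc_psumB_le c c' n t (e : R) :
  (forall i, (i < n)%N -> `|complex.Re (c i - c' i)| <= e) ->
  (forall i, (i < n)%N -> `|complex.Im (c i - c' i)| <= e) ->
  normc (psum c n t - psum c' n t) <= n%:R * (2 * e).
Proof.
move=> hr hi; have -> : psum c n t - psum c' n t = psum (fun i => c i - c' i) n t.
  elim: n {hr hi} => [|n IH]; first by rewrite !psum0 subr0.
  by rewrite !psumS -IH; ring.
rewrite (le_trans (normc_psum_le _ _ _))//.
have -> : n%:R * (2 * e) = \sum_(0 <= i < n) (2 * e).
  by rewrite sumr_const_nat subn0 mulr_natl.
rewrite !big_nat; apply: ler_sum => i /andP[_ ni].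
by rewrite (le_trans (normc_ReIm _))// mulr_natl mulr2n lerD ?hr ?hi.
Qed.

Lemma badm_sub c c' f n k m (e d : R) : (k <= m)%N ->
  (forall i t, (i <= k)%N -> normc (psum c i t - psum c' i t) <= d) ->
  badm c f n k (e + d) `<=` badm c' f n m e.
Proof.
move=> km hd t [ct [i /andP[ni ik] h]]; split => //; exists i.
  by rewrite ni (leq_trans ik).
have := hd i t ik.
have -> : psum c i t - psum c' i t = (psum c i t - f t) - (psum c' i t - f t) by ring.
have := le_normcB (psum c i t - f t) (psum c' i t - f t).
lra.
Qed.

Lemma rat_approx (x e : R) : 0 < e -> exists q : rat, `|ratr q - x| < e.
Proof.
move=> e0; have [q] := @rat_in_itvoo R (x - e) (x + e) ltac:(lra).
by rewrite in_itv/= => /andP[a b]; exists q; rewrite ltr_norml; apply/andP; split; lra.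
Qed.

Lemma prelevel_level N k f : cont_on f -> prelevel (mkseq N k) f -> level N k f.
Proof.
move=> cf [c [rc]]; rewrite size_mkseq => hc.
(* Moving real and imaginary parts of the first k coefficients by [e] changes the partial sums up to
   index k by at most (1/2) / 2^k, the slack between [prelevel] and [level]. *)
pose e : R := (2^-1 / 2 ^+ k) / (2 * k.+1%:R).
have e0 : 0 < e by rewrite divr_gt0// ?mulr_gt0// ?divr_gt0// ?exprn_gt0// invr_gt0.
have /choice[q1 hq1] : forall i, exists q : rat, `|ratr q - complex.Re (c i)| < e.
  by move=> i; exact: rat_approx.
have /choice[q2 hq2] : forall i, exists q : rat, `|ratr q - complex.Im (c i)| < e.
  by move=> i; exact: rat_approx.
pose q := mkseq (fun i => (q1 i, q2 i)) k; exists q => j jk.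
have qE i : (i < k)%N -> rat_coef q i = ratr (q1 i) +i* ratr (q2 i).
  by move=> ik; rewrite /rat_coef nth_mkseq.
have [h1 h2 h3] := hc j jk; rewrite nth_mkseq// in h1 h2 h3.
have e1 : e <= 1.
  rewrite ler_pdivrMr ?mulr_gt0// mul1r ler_pdivrMr ?exprn_gt0//.
  have : 1 <= 2 ^+ k :> R by rewrite exprn_ege1// ler1n.
  have : 1 <= k.+1%:R :> R by rewrite ler1n.
  nra.
split.
- rewrite qE//= -natr1; have h := ltW (hq1 j).
  rewrite -(subrK (complex.Re (c j)) (ratr (q1 j))).
  by rewrite (le_trans (ler_normD _ _))//; lra.
- rewrite qE//= -natr1; have h := ltW (hq2 j).
  rewrite -(subrK (complex.Im (c j)) (ratr (q2 j))).
  by rewrite (le_trans (ler_normD _ _))//; lra.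
apply: le_trans h3; apply: le_measure.
- by apply/mem_set; exact: measurable_badm.
- by apply/mem_set; exact: measurable_bad.
rewrite badE; apply: subset_trans (@bigcup_sup _ _ k _ (fun m => badm c f (N j) m _) I).
have -> : 1 / 2 ^+ j = 2^-1 / 2 ^+ j + 2^-1 / 2 ^+ j :> R.
  by rewrite -mulrDl; congr (_ / _); field.
apply: badm_sub => // i t ik.
apply: (@le_trans _ _ (i%:R * (2 * e))).
  apply: normc_psumB_le => u ui; rewrite qE ?(leq_trans ui)//.
    by case: (c u) (hq1 u) => a b /= /ltW.
  by case: (c u) (hq2 u) => a b /= /ltW.
apply: (@le_trans _ _ (k.+1%:R * (2 * e))).
  rewrite ler_wpM2r ?mulr_ge0 ?(ltW e0)// ler_nat; exact: leqW.
have -> : k.+1%:R * (2 * e) = 2^-1 / 2 ^+ k.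
  by rewrite /e; field; rewrite gt_eqF ?exprn_gt0//= pnatr_eq0.
rewrite ler_wpM2l// lef_pV2 ?posrE ?exprn_gt0// ler_eXn2l ?ltr1n//; exact: ltnW.
Qed.

Lemma levelS N k f : cont_on f -> level N k.+1 f -> level N k f.
Proof.
move=> cf [q hq]; exists q => j jk; have [a b h] := hq j (leqW jk); split => //.
apply: le_trans h; apply: le_measure.
- by apply/mem_set; exact: measurable_badm.
- by apply/mem_set; exact: measurable_badm.
by move=> t [ct [i /andP[ni ik] h]]; split => //; exists i => //; rewrite ni leqW.
Qed.

(** The coefficients witnessing level k lie in a product of compact intervals, so by Tychonoff they
    have a cluster point. A partial sum up to index m involves finitely many coordinates, hence some
    late witness is close on all of them; then m goes to infinity. *)
Lemma level_almost_unif N f : cont_on f -> (forall k, level N k f) ->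
  exists c, almost_unif c f N.
Proof.
move=> cf /choice[q hq].
pose A (bi : bool * nat) : set R := `[- (N bi.2).+1%:R, (N bi.2).+1%:R]%classic.
(* The boolean separates real and imaginary parts. Coordinates not yet constrained at level k are
   set to 0 so that the point stays in the compact box. *)
pose x k : bool * nat -> R := fun bi => if (bi.2 < k)%N then
  (if bi.1 then complex.Re (rat_coef (q k) bi.2) else complex.Im (rat_coef (q k) bi.2))
  else 0.
have cA : @compact (prod_topology (fun _ : bool * nat => R))
    [set y | forall bi, A bi (y bi)].
  by apply: tychonoff => bi; exact: segment_compact.
have [|y [_ yx]] := cA (x @ \oo) _.
  exists 0%N => // k _ [b i]; rewrite /x /A /= in_itv/= -ler_norml.
  have [ik|_] := ltnP i k; last by rewrite normr0.
  by have [h1 h2 _] := hq k i ik; case: b.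
pose c i := y (true, i) +i* y (false, i).
exists c => j.
rewrite badE.
have mB m : measurable (badm c f (N j) m (2 / 2 ^+ j)) by exact: measurable_badm.
have : lambda (badm c f (N j) m (2 / 2 ^+ j)) @[m --> \oo] -->
    lambda (\bigcup_m badm c f (N j) m (2 / 2 ^+ j)).
  apply: nondecreasing_cvg_mu => //; first exact: bigcupT_measurable.
  move=> n m nm; apply/subsetPset => t [ct [i /andP[ni im] h]]; split => //.
  by exists i => //; rewrite ni (leq_trans im).
move=> /cvge_to_le; apply; apply: nearW => m.
pose e : R := (1 / 2 ^+ j) / (2 * m.+1%:R).
have e0 : 0 < e by rewrite divr_gt0// ?mulr_gt0// divr_gt0// exprn_gt0.
pose K := maxn m j.+1.
have nA : (x @ \oo) [set x k | k in [set k | (K <= k)%N]].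
  by exists K => // k Kk; exists k.
have nB : nbhs y [set z : prod_topology (fun _ : bool * nat => R) |
    forall bi : bool * 'I_m, `|y (bi.1, bi.2 : nat) - z (bi.1, bi.2 : nat)| < e].
  apply: (@filter_forall _ _ (fun (bi : bool * 'I_m)
    (z : prod_topology (fun _ : bool * nat => R)) =>
    `|y (bi.1, bi.2 : nat) - z (bi.1, bi.2 : nat)| < e) (nbhs y) _) => -[b i].
  have h : (fun z : prod_topology (fun _ : bool * nat => R) => z (b, i : nat)) @ y
      --> (y (b, i : nat) : R) by exact: (@proj_continuous _ (fun=> R) (b, i : nat) y).
  exact: (@cvgr_dist_lt R R _ _ _ _ _ h e e0).
have [_ [[k Kk <-] /= hk]] := yx _ _ nA nB.
have /andP[mk jk] : (m <= k)%N && (j < k)%N by rewrite -geq_max.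
have [_ _ h] := hq k j jk; apply: le_trans h; apply: le_measure.
- by apply/mem_set; exact: mB.
- by apply/mem_set; exact: measurable_badm.
have -> : 2 / 2 ^+ j = 1 / 2 ^+ j + 1 / 2 ^+ j :> R by rewrite -mulrDl; congr (_ / _); ring.
apply: badm_sub => // i t im.
apply: (@le_trans _ _ (i%:R * (2 * e))).
  apply: (@normc_psumB_le c (rat_coef (q k)) i t e) => u ui; have um := leq_trans ui im.
    have := hk (true, Ordinal um); rewrite /x /= (leq_trans um)//.
    by rewrite /c; case: (rat_coef (q k) u) => a b /= /ltW.
  have := hk (false, Ordinal um); rewrite /x /= (leq_trans um)//.
  by rewrite /c; case: (rat_coef (q k) u) => a b /= /ltW.
apply: (@le_trans _ _ (m.+1%:R * (2 * e))).
  rewrite ler_wpM2r ?mulr_ge0 ?(ltW e0)// ler_nat; exact: leqW.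
have -> : m.+1%:R * (2 * e) = 1 / 2 ^+ j; last by [].
by rewrite /e; field; rewrite gt_eqF ?exprn_gt0//= pnatr_eq0.
Qed.

Section probability.
Context d (S : measurableType d) (W : probability S R) (f : S -> R -> R[i]).
Hypothesis cont_f : forall s, cont_on (f s).
Hypothesis mRe : forall l i, (i < 2 ^ l)%N ->
  measurable_fun setT (fun s => complex.Re (f s (node R (2 ^ l) i))).
Hypothesis mIm : forall l i, (i < 2 ^ l)%N ->
  measurable_fun setT (fun s => complex.Im (f s (node R (2 ^ l) i))).

Lemma measurable_level N k : measurable [set s | level N k (f s)].
Proof.
have -> : [set s | level N k (f s)] = \bigcup_q \bigcap_j [set s | (j < k)%N ->
  [/\ `|complex.Re (rat_coef q j)| <= (N j).+1%:R,
      `|complex.Im (rat_coef q j)| <= (N j).+1%:R &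
      (lambda (badm (rat_coef q) (f s) (N j) k (1 / 2 ^+ j)) <= (1 / 2 ^+ j)%:E)%E]].
  by apply/seteqP; split => [s [q hq]|s [q _ hq]]; exists q => // j *; exact: hq.
apply: countable_bigcupT_measurable => [|q]; first exact: countableP.
apply: bigcapT_measurable => j.
have mT (P : S -> Prop) : (forall s, P s) -> measurable [set s | P s].
  by move=> h; rewrite (_ : [set s | P s] = setT)//; apply/seteqP; split => // s _; exact: h.
have m0 (P : S -> Prop) : (forall s, ~ P s) -> measurable [set s | P s].
  by move=> h; rewrite (_ : [set s | P s] = set0)//; apply/seteqP; split => [s /(h s)|s []].
have [jk|jk] := boolP (j < k)%N; last exact: mT.
have [h1|h1] := boolP (`|complex.Re (rat_coef q j)| <= (N j).+1%:R); last first.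
  by apply: m0 => s /(_ isT)[].
have [h2|h2] := boolP (`|complex.Im (rat_coef q j)| <= (N j).+1%:R); last first.
  by apply: m0 => s /(_ isT)[].
rewrite (_ : [set s | _] = [set s |
  (lambda (badm (rat_coef q) (f s) (N j) k (1 / 2 ^+ j)) <= (1 / 2 ^+ j)%:E)%E]).
  exact: measurable_badm_le.
by apply/seteqP; split => s /=; [case/(_ isT)|move=> h _].
Qed.

Lemma measurable_all_levels N : measurable [set s | forall k, level N k (f s)].
Proof.
have -> : [set s | forall k, level N k (f s)] = \bigcap_k [set s | level N k (f s)].
  by apply/seteqP; split => s h k; [move=> _|]; exact: h.
by apply: bigcapT_measurable => k; exact: measurable_level.
Qed.

(** Outer measure at most [a], for sets not known to be measurable. *)
Let covered (a : R) (A : set S) :=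
  exists U, [/\ measurable U, A `<=` U & (W U <= a%:E)%E].

Let negligible_of_covered A : (forall a : R, 0 < a -> covered a A) -> W.-negligible A.
Proof.
move=> h; have /choice[U hU] : forall n : nat, exists U,
    [/\ measurable U, A `<=` U & (W U <= (n.+1%:R^-1)%:E)%E].
  by move=> n; apply: h; rewrite invr_gt0.
have mU : measurable (\bigcap_n U n) by apply: bigcapT_measurable => n; case: (hU n).
exists (\bigcap_n U n); split => //; last by move=> s As n _; case: (hU n) => _ + _; exact.
apply/eqP; rewrite eq_le measure_ge0 andbT; apply/lee_addgt0Pr => e e0.
rewrite add0e; pose n := Num.truncn e^-1.
have [mUn _ /le_trans] := hU n; move=> /(_ e%:E) h'.
apply: (@le_trans _ _ (W (U n))).
  by apply: le_measure; [exact/mem_set|exact/mem_set|move=> s /(_ n I)].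
apply: h'; rewrite lee_fin ltW// invf_plt ?posrE ?ltr0n//.
by have /andP[] := truncn_itv (ltW (eqbRL (@invr_gt0 _ _) e0)).
Qed.

(** Continuity of outer measure along increasing unions, in liminf form: the intersections of the
    covers from index n on increase with n, and their union contains [B]. *)
Let covered_liminf (a : R) (A : nat -> set S) (B : set S) :
  (forall s, B s -> exists n, forall m, (n <= m)%N -> A m s) ->
  (forall n, covered a (A n)) -> covered a B.
Proof.
move=> hB /choice[U hU]; pose V n := \bigcap_(m in [set m | (n <= m)%N]) U m.
have mV n : measurable (V n) by apply: bigcap_measurable => [|m _]; [exists n => /=|case: (hU m)].
have mVV : measurable (\bigcup_n V n) by exact: bigcupT_measurable.
exists (\bigcup_n V n); split => //.
  by move=> s /hB[n hn]; exists n => // m nm; case: (hU m) => _ + _; apply; exact: hn.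
have : W (V n) @[n --> \oo] --> W (\bigcup_n V n).
  apply: nondecreasing_cvg_mu => //.
  by move=> n m nm; apply/subsetPset => s hs i im; apply: hs => /=; exact: leq_trans im.
move=> /cvge_to_le; apply; apply: nearW => n.
have [mU _] := hU n; apply: le_trans; apply: le_measure; [exact/mem_set|exact/mem_set|].
by move=> s; apply => /=.
Qed.

(* Choquet capacitability, by hand: the set of f s that are sums of an analytic
   series is a Souslin set, i.e. a union over the sequences N of the closed sets
   [forall k, level N k]; a set that cannot be covered by a measurable set of
   measure at most a contains one of them of measure at least a. *)
Theorem negligible_represented :
  (forall N, W [set s | forall k, level N k (f s)] = 0%E) ->
  W.-negligible [set s | exists c, represents c (f s)].
Proof.
move=> null; apply: negligible_of_covered => a a0; apply: contrapT => ncov.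
pose A l := [set s | prelevel l (f s)].
(* If every extension of [l] were covered, [covered_liminf] and [prelevel_rcons] would cover A l.
   Iterating [g] builds the branch [N] term by term. *)
have /choice[g hg] : forall l, exists n, ~ covered a (A l) -> ~ covered a (A (rcons l n)).
  move=> l; apply: contrapT => /forallNP h.
  have h1 n : ~ covered a (A l) /\ covered a (A (rcons l n)).
    by have /not_implyP[? /contrapT] := h n.
  case: (h1 0%N) => nl _; apply: nl.
  apply: (@covered_liminf a (fun n => A (rcons l n))) => [s As|n]; last by case: (h1 n).
  exact: prelevel_rcons.
pose L k := iter k (fun l => rcons l (g l)) [::].
pose N k := g (L k).
have LE k : L k = mkseq N k.
  by elim: k => // k IH; rewrite mkseqS -IH /L iterS.
have nL k : ~ covered a (A (L k)).
  elim: k => [|k IH]; last exact: hg.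
  move=> [U [mU AU WU]]; apply: ncov; exists U; split => //.
  by move=> s [c rc]; apply: AU; exists c; split.
have big k : (a%:E <= W [set s | level N k (f s)])%E.
  rewrite leNgt; apply/negP => lt; apply: (nL k); exists [set s | level N k (f s)]; split.
  - exact: measurable_level.
  - by move=> s; rewrite /A LE /=; exact: prelevel_level.
  - exact: ltW.
have : W [set s | level N k (f s)] @[k --> \oo] --> W [set s | forall k, level N k (f s)].
  have -> : [set s | forall k, level N k (f s)] = \bigcap_k [set s | level N k (f s)].
    by apply/seteqP; split => s h k; [move=> _|]; exact: h.
  apply: nonincreasing_cvg_mu => //.
  - by rewrite (le_lt_trans (probability_le1 _ _))// ?ltry//; exact: measurable_level.
  - by move=> k; exact: measurable_level.
  - by apply: bigcapT_measurable => k; exact: measurable_level.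
  move=> n m nm; apply/subsetPset => s /=.
  elim: m nm => [|m IH]; first by rewrite leqn0 => /eqP->.
  by rewrite leq_eqVlt ltnS => /orP[/eqP->//|nm] /(levelS (cont_f s)); exact: IH.
rewrite null => /cvge_to_ge => /(_ a%:E) h.
have : (a%:E <= 0)%E by apply: h; exact: nearW.
by rewrite lee_fin leNgt a0.
Qed.

End probability.

End capacity.

(** * Independence of past and future of a Brownian motion *)

Section independence.
Context d (T : measurableType d) (R : realType) (P : probability T R).
Implicit Types (G H : set (set T)).
Local Open Scope ereal_scope.

Definition indep G H := forall A C, G A -> H C -> P (A `&` C) = P A * P C.

Lemma indepC G H : indep G H -> indep H G.
Proof. by move=> GH A C HA GC; rewrite setIC GH// muleC. Qed.

Lemma sub_sigma G : G `<=` measurable -> <<s G >> `<=` measurable.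
Proof. by apply: smallest_sub; exact: sigma_algebra_measurable. Qed.

(** For a fixed event C, the restriction of P to C and the multiple of P by P C are finite measures
    that agree on a pi-system, hence on the sigma-algebra it generates. *)
Lemma indep_sigmal G H : G setT -> setI_closed G -> G `<=` measurable ->
  H `<=` measurable -> indep G H -> indep <<s G >> H.
Proof.
move=> GT GI Gm Hm GH A C sA HC; have mC := Hm _ HC.
have PC : P C = (fine (P C))%:E by rewrite fineK// fin_num_measure.
pose c : {nonneg R} := NngNum (fine_ge0 (measure_ge0 P C)).
pose m1 := mrestr P mC; pose m2 := mscale c P.
rewrite -[LHS]/(m1 A) muleC PC -[RHS]/(m2 A).
apply: (@g_sigma_algebra_measure_unique _ _ _ G Gm (fun=> setT) _ _ m1 m2) => //.
- by rewrite bigcup_const.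
- by move=> B GB; have h := GH B C GB HC; rewrite PC muleC in h; exact: h.
- by move=> _; rewrite -[X in X < _]/(P (setT `&` C)) setTI PC ltry.
Qed.

Lemma indep_sigma G H : G setT -> H setT -> setI_closed G -> setI_closed H ->
  G `<=` measurable -> H `<=` measurable -> indep G H -> indep <<s G >> <<s H >>.
Proof.
move=> GT HT GI HI Gm Hm GH; apply: indep_sigmal => //; first exact: sub_sigma.
by apply: indepC; apply: indep_sigmal => //; exact: indepC.
Qed.

Definition rect (X : nat -> T -> R) (I : set nat) : set (set T) :=
  [set E | exists2 A : nat -> set R, forall i, measurable (A i) &
     E = \bigcap_(i in I) (X i @^-1` A i)].

Lemma rectT X I : rect X I setT.
Proof.
exists (fun=> setT) => //; apply/seteqP; split => // w _ i _; exact: I0.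
Qed.

Lemma rect_setI X I : setI_closed (rect X I).
Proof.
move=> _ _ [A mA ->] [B mB ->]; exists (fun i => A i `&` B i).
  by move=> i; exact: measurableI.
by rewrite -bigcapI; apply: eq_bigcapr => i _; rewrite preimage_setI.
Qed.

Lemma rect_measurable X I : (forall i, I i -> measurable_fun setT (X i)) ->
  rect X I `<=` measurable.
Proof.
move=> mX _ [A mA ->]; apply: bigcap_measurableType => i Ii.
by rewrite -[X in measurable X]setTI; exact: mX.
Qed.

Lemma rect_measurable_fun X I i : I i ->
  measurable_fun setT (X i : g_sigma_algebraType (rect X I) -> R).
Proof.
move=> Ii _ B mB; rewrite setTI; apply: sub_sigma_algebra.
exists (fun j => if j == i then B else setT); first by move=> j; case: ifP.
apply/seteqP; split => [w Bw j Ij /=|w h]; first by case: eqP => [->|].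
by have := h i Ii; rewrite /= eqxx.
Qed.

End independence.

Section brownian_independence.
Context d (Omega : measurableType d) (R : realType) (P : probability Omega R).
Variables B V : R -> Omega -> R.
Hypothesis BM : brownian_motion P B.
Hypothesis mV : forall t, 0 <= t -> measurable_fun setT (V t).
Hypothesis indepBV : forall (n : nat) (t : nat -> R), (forall i, 0 <= t i) ->
  forall A A' : nat -> set R,
  (forall i, measurable (A i)) -> (forall i, measurable (A' i)) ->
  P (\bigcap_(i < n) [set w | A i (B (t i) w)] `&`
     \bigcap_(i < n) [set w | A' i (V (t i) w)]) =
  (P (\bigcap_(i < n) [set w | A i (B (t i) w)]) *
   P (\bigcap_(i < n) [set w | A' i (V (t i) w)]))%E.

Let mB := brownian_measurable BM.

(* The fraction 1/512 of the circle left after cut_time is small enough for the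
   exceptional set in linear_fibre to have measure at most 1/20. *)
Definition cut_time : R := 2 * pi * (1 - 512^-1).

(** The factor 2^9 = 512 makes [cut_time] a node of every grid. *)
Definition fine_size (l : nat) : nat := (2 ^ (l + 9))%N.
Definition cut_index (l : nat) : nat := (511 * 2 ^ l)%N.
Definition fine_node (l i : nat) : R := node R (fine_size l) i.

Lemma fine_size_gt0 l : 0 < (fine_size l)%:R :> R.
Proof. by rewrite ltr0n expn_gt0. Qed.

Lemma cut_index_le l : (cut_index l <= fine_size l)%N.
Proof. by rewrite /cut_index /fine_size expnD mulnC leq_mul2l orbC. Qed.

Lemma fine_node0 l : fine_node l 0 = 0.
Proof. by rewrite /fine_node /node mulr0 mul0r. Qed.

Lemma fine_node_ge0 l i : 0 <= fine_node l i.
Proof. by rewrite /fine_node /node divr_ge0 ?mulr_ge0 ?pi_ge0. Qed.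

Lemma fine_node_lt l i : fine_node l i < fine_node l i.+1.
Proof.
by rewrite /fine_node /node ltr_pM2r ?invr_gt0 ?fine_size_gt0// ltr_pM2l ?pi2_gt0// ltr_nat.
Qed.

Lemma fine_node_cut l : fine_node l (cut_index l) = cut_time.
Proof.
rewrite /fine_node /node /cut_index /fine_size /cut_time expnD !natrM !natrX.
have : 0 < 2 ^+ l :> R by rewrite exprn_gt0.
by move: (@pi R) (2 ^+ l) => p x x0; field; rewrite gt_eqF.
Qed.

Lemma fine_node_end l : fine_node l (fine_size l) = 2 * pi.
Proof. by rewrite /fine_node /node mulfK// gt_eqF// fine_size_gt0. Qed.

Lemma fine_node_refine l m i : fine_node (l + m) (i * 2 ^ m) = fine_node l i.
Proof.
rewrite /fine_node /node /fine_size addnAC expnD !natrM.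
have := fine_size_gt0 l; rewrite /fine_size.
have : 0 < (2 ^ m)%:R :> R by rewrite ltr0n expn_gt0.
move: (@pi R) (2 ^ m)%:R ((2 ^ (l + 9))%:R) => p x y x0 y0.
by field; rewrite !gt_eqF.
Qed.

Let D l i : Omega -> R := B (fine_node l i.+1) \- B (fine_node l i).

Let before l := [set i | (i < cut_index l)%N].
Let after l := [set i | (cut_index l <= i < fine_size l)%N].

Let mD l i : measurable_fun setT (D l i).
Proof. by apply: measurable_funB; apply: mB; exact: fine_node_ge0. Qed.

Lemma indep_increments l : indep P (rect (D l) (before l)) (rect (D l) (after l)).
Proof.
have prod A : (forall i, measurable (A i)) ->
  P (\bigcap_(i < fine_size l) (D l i @^-1` A i)) =
  (\prod_(i < fine_size l) P (D l i @^-1` A i))%E.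
  move=> mA; apply: (brownian_independent BM) => //; first by rewrite fine_node0.
  by move=> i _; exact: fine_node_lt.
move=> _ _ [A mA ->] [C mC ->].
(* The product formula speaks of all increments at once, so both events are padded with the full set
   at the indices they do not constrain. *)
have -> : \bigcap_(i in before l) (D l i @^-1` A i) =
   \bigcap_(i < fine_size l) (D l i @^-1` (if (i < cut_index l)%N then A i else setT)).
  apply/seteqP; split => w h i /=.
    by case: ifP => // ik _; exact: h.
  move=> ik; have := h i (leq_trans ik (cut_index_le l)).
  by rewrite /= ifT.
have -> : \bigcap_(i in after l) (D l i @^-1` C i) =
   \bigcap_(i < fine_size l) (D l i @^-1` (if (i < cut_index l)%N then setT else C i)).
  apply/seteqP; split => w h i /=.
    by move=> iG; case: ltnP => // ki; apply: (h i); rewrite /after /= ki.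
  by move=> /andP[ki iG]; have := h i iG; rewrite /= ifF// ltnNge ki.
rewrite -bigcapI.
under eq_bigcapr => i _ do rewrite -preimage_setI.
rewrite (prod (fun i => (if (i < cut_index l)%N then A i else setT) `&`
   (if (i < cut_index l)%N then setT else C i))); last first.
  by move=> i; case: ifP => _; [rewrite setIT|rewrite setTI].
rewrite !prod; try by move=> i; case: ifP.
rewrite -big_split/=; apply: eq_bigr => i _; case: ifP => _.
  by rewrite setIT preimage_setT probability_setT mule1.
by rewrite setTI preimage_setT probability_setT mul1e.
Qed.

Let VB l := rect (fun i => B (fine_node l i)) [set i | (i < (fine_size l).+1)%N].
Let VV l := rect (fun i => V (fine_node l i)) [set i | (i < (fine_size l).+1)%N].

Let indep_values l : indep P <<s VB l >> <<s VV l >>.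
Proof.
apply: indep_sigma; try exact: rectT; try exact: rect_setI.
- by apply: rect_measurable => i _; apply: mB; exact: fine_node_ge0.
- by apply: rect_measurable => i _; apply: mV; exact: fine_node_ge0.
move=> _ _ [A mA ->] [A' mA' ->].
by apply: indepBV => // i; exact: fine_node_ge0.
Qed.

Let R1 l := rect (D l) (before l).
Let R2 l := rect (D l) (after l).

Let R1_VB l : <<s R1 l >> `<=` <<s VB l >>.
Proof.
apply: smallest_sub; first exact: smallest_sigma_algebra.
apply: (@rect_measurable _ (g_sigma_algebraType (VB l)) R (D l)) => i ik.
by apply: measurable_funB; apply: (@rect_measurable_fun _ _ R (fun i => B (fine_node l i)));
  rewrite /= ltnS; [exact: leq_trans ik (cut_index_le l)|
                    exact: ltnW (leq_trans ik (cut_index_le l))].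
Qed.

Let R2_VB l : <<s R2 l >> `<=` <<s VB l >>.
Proof.
apply: smallest_sub; first exact: smallest_sigma_algebra.
apply: (@rect_measurable _ (g_sigma_algebraType (VB l)) R (D l)) => i /andP[_ ik].
by apply: measurable_funB; apply: (@rect_measurable_fun _ _ R (fun i => B (fine_node l i)));
  rewrite /= ltnS; [exact: ik|exact: ltnW].
Qed.

(** All of V, even after the cut, is counted as past: varying one real increment of B is enough, and
    V then cancels between two loops with the same past. *)
Definition past_gen l : set (set Omega) :=
  [set E | exists i A, [/\ (i <= cut_index l)%N, measurable A & E = B (fine_node l i) @^-1` A]]
  `|` [set E | exists i A, [/\ (i <= fine_size l)%N, measurable A & E = V (fine_node l i) @^-1` A]].

Definition future_gen l : set (set Omega) :=
  [set E | exists i A, [/\ (cut_index l <= i <= fine_size l)%N, measurable A &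
     E = (B (fine_node l i) \- B cut_time) @^-1` A]].

Let meets l : set (set Omega) :=
  [set E | exists A C, [/\ <<s R1 l >> A, <<s VV l >> C & E = A `&` C]].

Let sigmaT (G : set (set Omega)) : <<s G >> setT.
Proof. exact: (@measurableT _ (g_sigma_algebraType G)). Qed.

Let sigmaI (G : set (set Omega)) A C : <<s G >> A -> <<s G >> C -> <<s G >> (A `&` C).
Proof. exact: (@measurableI _ (g_sigma_algebraType G)). Qed.

Let R1_meas l : <<s R1 l >> `<=` measurable.
Proof. by apply: sub_sigma; apply: rect_measurable => i _; exact: mD. Qed.

Let R2_meas l : <<s R2 l >> `<=` measurable.
Proof. by apply: sub_sigma; apply: rect_measurable => i _; exact: mD. Qed.

Let VV_meas l : <<s VV l >> `<=` measurable.
Proof.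
by apply: sub_sigma; apply: rect_measurable => i _; apply: mV; exact: fine_node_ge0.
Qed.

Let indep_R l : indep P <<s R1 l >> <<s R2 l >>.
Proof.
apply: indep_sigma; try exact: rectT; try exact: rect_setI; last exact: indep_increments.
- by apply: rect_measurable => i _; exact: mD.
- by apply: rect_measurable => i _; exact: mD.
Qed.

(** For A before the cut, E after it and C from V, independence of B and V splits off C from A and
    E, and independence of increments splits A from E; regrouping gives P(A C) P(E). *)
Let indep_meets l : indep P <<s meets l >> <<s R2 l >>.
Proof.
apply: indep_sigmal.
- by exists setT, setT; split; rewrite ?setIT//; exact: sigmaT.
- move=> _ _ [A [C [hA hC ->]]] [A' [C' [hA' hC' ->]]].
  by exists (A `&` A'), (C `&` C'); rewrite setIACA; split => //; exact: sigmaI.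
- by move=> _ [A [C [/R1_meas mA /VV_meas mC ->]]]; exact: measurableI.
- exact: R2_meas.
move=> _ E [A [C [hA hC ->]]] hE.
rewrite setIAC (@indep_values l)//; last by apply: sigmaI; [exact: R1_VB|exact: R2_VB].
rewrite (@indep_R l)// muleAC (@indep_values l)//; exact: R1_VB.
Qed.

Let past_meets l : <<s past_gen l >> `<=` <<s meets l >>.
Proof.
apply: smallest_sub; first exact: smallest_sigma_algebra.
move=> _ [[i [A [ik mA ->]]]|[i [A [iG mA ->]]]]; last first.
  apply: sub_sigma_algebra; exists setT, (V (fine_node l i) @^-1` A).
  split; [exact: sigmaT| |by rewrite setTI].
  have := @rect_measurable_fun _ _ R (fun i => V (fine_node l i))
    [set i | (i < (fine_size l).+1)%N] i iG measurableT A mA.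
  by rewrite setTI.
apply: sub_sigma_algebra; exists (B (fine_node l i) @^-1` A), setT.
split; [|exact: sigmaT|by rewrite setIT].
have : measurable_fun setT (B (fine_node l i) : g_sigma_algebraType (R1 l) -> R).
  elim: i ik => [_|i IH ik].
    rewrite fine_node0 (_ : B 0 = cst 0) ?measurable_cst//.
    by apply/funext => w; rewrite (brownian_start BM).
  have -> : B (fine_node l i.+1) = D l i \+ B (fine_node l i).
    by apply/funext => w; rewrite /D /= subrK.
  by apply: measurable_funD; [exact: rect_measurable_fun|exact: IH (ltnW ik)].
by move=> /(_ measurableT A mA); rewrite setTI.
Qed.

Let future_R2 l : <<s future_gen l >> `<=` <<s R2 l >>.
Proof.
apply: smallest_sub; first exact: smallest_sigma_algebra.
move=> _ [i [A [/andP[ki iG] mA ->]]].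
have : measurable_fun setT (B (fine_node l i) \- B cut_time : g_sigma_algebraType (R2 l) -> R).
  have [m im] : exists m, i = (cut_index l + m)%N by exists (i - cut_index l)%N; rewrite subnKC.
  rewrite im; rewrite im in iG; elim: m iG {ki im i} => [_|m IH mG].
    rewrite addn0 fine_node_cut (_ : B cut_time \- B cut_time = cst 0) ?measurable_cst//.
    by apply/funext => w /=; rewrite subrr.
  rewrite addnS in mG *.
  have -> : B (fine_node l (cut_index l + m).+1) \- B cut_time =
     D l (cut_index l + m) \+ (B (fine_node l (cut_index l + m)) \- B cut_time).
    by apply/funext => w; rewrite /D /=; ring.
  apply: measurable_funD; last exact: IH (ltnW mG).
  by apply: rect_measurable_fun; rewrite /after /= leq_addr.
by move=> /(_ measurableT A mA); rewrite setTI.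
Qed.

Let indep_level l : indep P <<s past_gen l >> <<s future_gen l >>.
Proof. by move=> A C /past_meets hA /future_R2 hC; exact: (@indep_meets l). Qed.

Let past_mono l m : <<s past_gen l >> `<=` <<s past_gen (l + m) >>.
Proof.
apply: smallest_sub; first exact: smallest_sigma_algebra.
move=> _ [[i [A [ik mA ->]]]|[i [A [iG mA ->]]]]; apply: sub_sigma_algebra; [left|right];
  exists (i * 2 ^ m)%N, A; rewrite fine_node_refine; split => //.
  by rewrite /cut_index expnD mulnA leq_mul2r ik orbT.
by rewrite /fine_size addnAC expnD leq_mul2r iG orbT.
Qed.

Let future_mono l m : <<s future_gen l >> `<=` <<s future_gen (l + m) >>.
Proof.
apply: smallest_sub; first exact: smallest_sigma_algebra.
move=> _ [i [A [/andP[ki iG] mA ->]]]; apply: sub_sigma_algebra.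
exists (i * 2 ^ m)%N, A; rewrite fine_node_refine; split => //.
apply/andP; split; first by rewrite /cut_index expnD mulnA leq_mul2r ki orbT.
by rewrite /fine_size addnAC expnD leq_mul2r iG orbT.
Qed.

(** The union is a pi-system because refining the grid enlarges the sigma-algebras; that is what
    passing from each level to the limit requires. *)
Definition past : set (set Omega) := \bigcup_l <<s past_gen l >>.
Definition future : set (set Omega) := \bigcup_l <<s future_gen l >>.

Lemma past_measurable : past `<=` measurable.
Proof.
move=> A [l _]; apply: sub_sigma => _ [[i [C [_ mC ->]]]|[i [C [_ mC ->]]]].
  by rewrite -[X in measurable X]setTI; apply: mB => //; exact: fine_node_ge0.
by rewrite -[X in measurable X]setTI; apply: mV => //; exact: fine_node_ge0.
Qed.

Lemma future_measurable : future `<=` measurable.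
Proof.
move=> A [l _]; apply: sub_sigma => _ [i [C [_ mC ->]]].
rewrite -[X in measurable X]setTI; apply: measurable_funB => //; apply: mB.
  exact: fine_node_ge0.
by rewrite -(fine_node_cut 0); exact: fine_node_ge0.
Qed.

Lemma indep_past_future : indep P <<s past >> <<s future >>.
Proof.
apply: indep_sigma.
- by exists 0%N => //; exact: sigmaT.
- by exists 0%N => //; exact: sigmaT.
- move=> A C [l _ hA] [m _ hC]; exists (l + m)%N => //; apply: sigmaI.
    exact: past_mono.
  by rewrite addnC; exact: past_mono.
- move=> A C [l _ hA] [m _ hC]; exists (l + m)%N => //; apply: sigmaI.
    exact: future_mono.
  by rewrite addnC; exact: future_mono.
- exact: past_measurable.
- exact: future_measurable.
move=> A C [l _ hA] [m _ hC]; apply: (@indep_level (l + m)); first exact: past_mono.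
by rewrite addnC; exact: future_mono.
Qed.

Lemma past_measurable_B l i : (i <= cut_index l)%N ->
  measurable_fun setT (B (fine_node l i) : g_sigma_algebraType past -> R).
Proof.
move=> ik _ A mA; rewrite setTI; apply: sub_sigma_algebra; exists l => //.
by apply: sub_sigma_algebra; left; exists i, A.
Qed.

Lemma past_measurable_V l i : (i <= fine_size l)%N ->
  measurable_fun setT (V (fine_node l i) : g_sigma_algebraType past -> R).
Proof.
move=> ik _ A mA; rewrite setTI; apply: sub_sigma_algebra; exists l => //.
by apply: sub_sigma_algebra; right; exists i, A.
Qed.

Lemma future_measurable_B l i : (cut_index l <= i <= fine_size l)%N ->
  measurable_fun setT (B (fine_node l i) \- B cut_time : g_sigma_algebraType future -> R).
Proof.
move=> ik _ A mA; rewrite setTI; apply: sub_sigma_algebra; exists l => //.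
by apply: sub_sigma_algebra; exists i, A.
Qed.

End brownian_independence.

(** * Brownian loops *)

Section bridge.
Context d (Omega : measurableType d) (R : realType) (P : probability Omega R).
Variables B V : R -> Omega -> R.
Hypothesis BM : brownian_motion P B.
Hypothesis mV : forall t, 0 <= t -> measurable_fun setT (V t).
Hypothesis contV : forall w, {within `[0, +oo[, continuous (fun t => V t w)}.
Hypothesis indepBV : forall (n : nat) (t : nat -> R), (forall i, 0 <= t i) ->
  forall A A' : nat -> set R,
  (forall i, measurable (A i)) -> (forall i, measurable (A' i)) ->
  P (\bigcap_(i < n) [set w | A i (B (t i) w)] `&`
     \bigcap_(i < n) [set w | A' i (V (t i) w)]) =
  (P (\bigcap_(i < n) [set w | A i (B (t i) w)]) *
   P (\bigcap_(i < n) [set w | A' i (V (t i) w)]))%E.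

Local Notation cut := (cut_time R).
Local Notation past := (past B V).
Local Notation future := (future B).

(* The bridge whose past up to the time cut is that of w.1 and whose increments
   after it are those of w.2; the imaginary part is that of w.1. *)
Definition bridge_path (w : Omega * Omega) (t : R) : R[i] :=
  (B (Num.min t cut) w.1 + (B (Num.max t cut) w.2 - B cut w.2)
    - t / (2 * pi) * (B cut w.1 + (B (2 * pi) w.2 - B cut w.2)))
  +i* (V t w.1 - t / (2 * pi) * V (2 * pi) w.1).

Lemma bridge_path_diag w t :
  bridge_path (w, w) t = (B t w - t / (2 * pi) * B (2 * pi) w)
     +i* (V t w - t / (2 * pi) * V (2 * pi) w).
Proof.
rewrite /bridge_path /=; congr Complex.
by have [tc|ct] := leP t cut; ring.
Qed.

Lemma within_continuous_dist (g : R -> R) : {within `[0, +oo[, continuous g} ->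
  forall t, 0 <= t -> forall e : R, 0 < e ->
  exists2 dl : R, 0 < dl & forall u, 0 <= u -> `|u - t| < dl -> `|g u - g t| < e.
Proof.
move=> /subspace_continuousP cg t t0 e e0.
have := cg t; rewrite /= in_itv/= andbT => /(_ t0)/cvgrPdist_lt/(_ e e0).
move=> /nbhs_ballP[dl /= dl0 h]; exists dl => // u u0 ut; rewrite distrC; apply: h.
  by rewrite -ball_normE /ball_/= distrC.
by rewrite /= in_itv/= u0.
Qed.

Lemma ler_dist_min (x y z : R) : `|Num.min x z - Num.min y z| <= `|x - y|.
Proof.
have := ler_norm (x - y); have := ler_norm (y - x); rewrite distrC => a b.
by rewrite ler_norml; have [?|?] := leP x z; have [?|?] := leP y z;
  apply/andP; split; lra.
Qed.

Lemma ler_dist_max (x y z : R) : `|Num.max x z - Num.max y z| <= `|x - y|.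
Proof.
have := ler_norm (x - y); have := ler_norm (y - x); rewrite distrC => a b.
by rewrite ler_norml; have [?|?] := leP x z; have [?|?] := leP y z;
  apply/andP; split; lra.
Qed.

Lemma bridge_path_cont w : cont_on (bridge_path w).
Proof.
move=> t ct e e0; have t0 : 0 <= t by move: ct; rewrite /= in_itv/= => /andP[].
have pp := pi2_gt0 R.
have cut0 : 0 <= cut by rewrite -(fine_node_cut R 0) fine_node_ge0.
have e5 : 0 < e / 5 by rewrite divr_gt0.
have m0 : 0 <= Num.min t cut by rewrite le_min t0.
have M0 : 0 <= Num.max t cut by rewrite le_max t0.
have [d1 d10 h1] := within_continuous_dist (@brownian_continuous _ _ _ _ _ BM w.1) m0 e5.
have [d2 d20 h2] := within_continuous_dist (@brownian_continuous _ _ _ _ _ BM w.2) M0 e5.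
have [d3 d30 h3] := within_continuous_dist (@contV w.1) t0 e5.
pose k1 := B cut w.1 + (B (2 * pi) w.2 - B cut w.2).
pose k2 := V (2 * pi) w.1.
have lin (k : R) : exists2 dl : R, 0 < dl &
    forall u, `|u - t| < dl -> `|(u - t) / (2 * pi) * k| < e / 5.
  have k0 : 0 < (`|k| + 1) / (2 * pi) by rewrite divr_gt0// ltr_wpDl.
  exists (e / 5 / ((`|k| + 1) / (2 * pi))); first by rewrite divr_gt0.
  move=> u; rewrite ltr_pdivlMr//; apply: le_lt_trans.
  rewrite !normrM -mulrA ler_wpM2l// normfV (gtr0_norm pp) mulrC.
  by rewrite ler_pM2r ?invr_gt0// lerDl.
have [d4 d40 h4] := lin k1; have [d5 d50 h5] := lin k2.
exists (Num.min (Num.min (Num.min d1 d2) (Num.min d3 d4)) d5).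
  by rewrite !lt_min d10 d20 d30 d40 d50.
move=> u cu; have u0 : 0 <= u by move: cu; rewrite /= in_itv/= => /andP[].
rewrite !lt_min => /andP[/andP[/andP[u1 u2] /andP[u3 u4]] u5].
have um := ler_dist_min u t cut; have uM := ler_dist_max u t cut.
have a1 := h1 (Num.min u cut) ltac:(by rewrite le_min u0) (le_lt_trans um u1).
have a2 := h2 (Num.max u cut) ltac:(by rewrite le_max u0) (le_lt_trans uM u2).
have a3 := h3 u u0 u3; have a4 := h4 u u4; have a5 := h5 u u5.
apply: le_lt_trans (normc_ReIm _) _.
have -> : complex.Re (bridge_path w u - bridge_path w t) =
   (B (Num.min u cut) w.1 - B (Num.min t cut) w.1)
   + (B (Num.max u cut) w.2 - B (Num.max t cut) w.2) - (u - t) / (2 * pi) * k1.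
  by rewrite /bridge_path oppcE addcE /= /k1; ring.
have -> : complex.Im (bridge_path w u - bridge_path w t) =
   (V u w.1 - V t w.1) - (u - t) / (2 * pi) * k2.
  by rewrite /bridge_path oppcE addcE /= /k2; ring.
have := ler_normB (V u w.1 - V t w.1) ((u - t) / (2 * pi) * k2).
have := ler_normB (B (Num.min u cut) w.1 - B (Num.min t cut) w.1
   + (B (Num.max u cut) w.2 - B (Num.max t cut) w.2)) ((u - t) / (2 * pi) * k1).
have := ler_normD (B (Num.min u cut) w.1 - B (Num.min t cut) w.1)
   (B (Num.max u cut) w.2 - B (Num.max t cut) w.2).
lra.
Qed.

Lemma node_fine_node l i : node R (2 ^ l) i = fine_node R l (i * 2 ^ 9).
Proof.
rewrite /fine_node /node /fine_size expnD !natrM.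
have : 0 < (2 ^ l)%:R :> R by rewrite ltr0n expn_gt0.
have : 0 < (2 ^ 9)%:R :> R by rewrite ltr0n expn_gt0.
move: (@pi R) (2 ^ l)%:R ((2 ^ 9)%:R) => p x y x0 y0.
by field; rewrite !gt_eqF.
Qed.

Lemma fine_node_le l i j : (i <= j)%N -> fine_node R l i <= fine_node R l j.
Proof.
move=> ij; rewrite /fine_node /node ler_pM2r ?invr_gt0 ?fine_size_gt0//.
by rewrite ler_pM2l ?pi2_gt0// ler_nat.
Qed.

Lemma fine_node_min_cut l i :
  Num.min (fine_node R l i) cut = fine_node R l (minn i (cut_index l)).
Proof.
rewrite -(fine_node_cut R l); have [ik|/ltnW ki] := leqP i (cut_index l).
  by rewrite min_l// fine_node_le.
by rewrite min_r// fine_node_le.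
Qed.

Lemma fine_node_max_cut l i :
  Num.max (fine_node R l i) cut = fine_node R l (maxn i (cut_index l)).
Proof.
rewrite -(fine_node_cut R l); have [ik|/ltnW ki] := leqP i (cut_index l).
  by rewrite max_r// fine_node_le.
by rewrite max_l// fine_node_le.
Qed.

Let T1 := g_sigma_algebraType past.
Let T2 := g_sigma_algebraType future.

Let mB1 l i : (i <= cut_index l)%N ->
  measurable_fun setT (fun s : T1 * T2 => B (fine_node R l i) s.1).
Proof.
move=> ik; apply: (measurableT_comp (f := (B (fine_node R l i) : T1 -> R))) => //.
exact: past_measurable_B.
Qed.

Let mV1 l i : (i <= fine_size l)%N ->
  measurable_fun setT (fun s : T1 * T2 => V (fine_node R l i) s.1).
Proof.
move=> ik; apply: (measurableT_comp (f := (V (fine_node R l i) : T1 -> R))) => //.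
exact: past_measurable_V.
Qed.

Let mB2 l i : (cut_index l <= i <= fine_size l)%N ->
  measurable_fun setT (fun s : T1 * T2 => B (fine_node R l i) s.2 - B cut s.2).
Proof.
move=> ik; apply: (measurableT_comp
  (f := (B (fine_node R l i) \- B cut : T2 -> R))) => //.
exact: future_measurable_B.
Qed.

Let node_bound l i : (i < 2 ^ l)%N -> (i * 2 ^ 9 <= fine_size l)%N.
Proof. by move=> /ltnW il; rewrite /fine_size expnD leq_mul2r il orbT. Qed.

Lemma bridge_path_mRe l i : (i < 2 ^ l)%N ->
  measurable_fun setT (fun s : T1 * T2 => complex.Re (bridge_path s (node R (2 ^ l) i))).
Proof.
move=> /node_bound il; rewrite node_fine_node /bridge_path /=.
rewrite fine_node_min_cut fine_node_max_cut.
apply: measurable_funB; first apply: measurable_funD.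
- by apply: mB1; exact: geq_minr.
- by apply: mB2; rewrite leq_maxr geq_max il cut_index_le.
apply: measurable_funM => //; apply: measurable_funD.
  by rewrite -(fine_node_cut R l); apply: mB1.
by rewrite -(fine_node_end R l); apply: mB2; rewrite cut_index_le leqnn.
Qed.

Lemma bridge_path_mIm l i : (i < 2 ^ l)%N ->
  measurable_fun setT (fun s : T1 * T2 => complex.Im (bridge_path s (node R (2 ^ l) i))).
Proof.
move=> /node_bound il; rewrite node_fine_node /bridge_path /=.
apply: measurable_funB; first exact: mV1.
by apply: measurable_funM => //; rewrite -(fine_node_end R l); apply: mV1.
Qed.

(** The law of the increment is dominated by Lebesgue measure, so it has no atoms. *)
Lemma future_end_null (r : R) : P [set w | B (2 * pi) w - B cut w = r] = 0%E.
Proof.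
have pp := pi2_gt0 R.
have cut0 : 0 <= cut by rewrite -(fine_node_cut R 0) fine_node_ge0.
have cutlt : cut < 2 * pi by rewrite /cut_time; lra.
have := brownian_increment BM cut0 cutlt (measurable_set1 r).
rewrite -[X in P X = _]/([set w | B (2 * pi) w - B cut w = r]) => ->.
have /null_content_dominatesP h :=
  @normal_prob_dominates R 0 (Num.sqrt (2 * pi - cut)).
by apply: h; [exact: measurable_set1|exact: lebesgue_measure_set1].
Qed.

Lemma bridge_fibre N w w' w'' :
  (forall k, level N k (bridge_path (w, w'))) ->
  (forall k, level N k (bridge_path (w, w''))) ->
  B (2 * pi) w' - B cut w' = B (2 * pi) w'' - B cut w''.
Proof.
move=> /(level_almost_unif (bridge_path_cont _))[c1 h1].
move=> /(level_almost_unif (bridge_path_cont _))[c2 h2].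
set r := B (2 * pi) w' - B cut w'; set s := B (2 * pi) w'' - B cut w''.
have pp := pi2_gt0 R.
have : ((s - r) / (2 * pi))%:C = 0.
  apply: (linear_fibre (bridge_path_cont _) (bridge_path_cont _) h1 h2) => t /andP[t0 tc].
  (* Before the cut the second path enters only through the closing term, which leaves the slope (s
     - r) / 2pi; the imaginary parts cancel. *)
  rewrite /bridge_path /= min_l// max_r// oppcE addcE mulcE -/r -/s.
  by congr Complex; ring.
move=> /(congr1 (@complex.Re R))/= /eqP.
by rewrite mulf_eq0 invr_eq0 (gt_eqF pp) orbF subr_eq0 => /eqP ->.
Qed.

Lemma bridge_null N : P [set w | forall k, level N k (bridge_path (w, w))] = 0%E.
Proof.
(* The two coordinates are the same point of Omega, seen through the past and the future
   sigma-algebra respectively. *)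
have m1 : measurable_fun setT (id : Omega -> T1).
  by move=> _ A mA; rewrite setTI; apply: sub_sigma mA; exact: (past_measurable BM mV).
have m2 : measurable_fun setT (id : Omega -> T2).
  by move=> _ A mA; rewrite setTI; apply: sub_sigma mA; exact: (future_measurable BM).
have md : measurable_fun setT ((fun w => (w, w)) : Omega -> T1 * T2).
  exact: measurable_fun_pair.
pose X1 : {mfun Omega >-> T1} := mfun_Sub (mem_set m1).
pose X2 : {mfun Omega >-> T2} := mfun_Sub (mem_set m2).
pose Xd : {mfun Omega >-> (T1 * T2)%type} := mfun_Sub (mem_set md).
have mX := measurable_all_levels (S := (T1 * T2)%type) bridge_path_cont
   bridge_path_mRe bridge_path_mIm N.
pose K := [set s : T1 * T2 | forall k, level N k (bridge_path s)].
(* Independence of past and future says exactly that the diagonal map has the product law, so its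
   null sets can be found by Fubini. *)
have PdE : distribution P Xd K = (distribution P X1 \x distribution P X2)%E K.
  apply/esym; apply: product_measure_unique => // A C mA mC.
  rewrite -[LHS]/(P (A `&` C)) -[RHS]/(P A * P C)%E.
  exact: (indep_past_future BM mV indepBV).
rewrite -[LHS]/(distribution P Xd K) PdE.
apply: integral0_eq => w _ /=.
rewrite -[LHS]/(P (xsection K w)).
(* Any point of a nonempty section fixes the last increment of all the others, so the section lies
   in a single value event. *)
have [->|/set0P[w']] := eqVneq (xsection K w) set0; first by rewrite measure0.
rewrite /xsection /= inE => Kw'.
apply/eqP; rewrite eq_le measure_ge0 andbT.
rewrite -(future_end_null (B (2 * pi) w' - B cut w')); apply: le_measure.
- apply/mem_set; apply: (sub_sigma (future_measurable BM)).
  exact: (@measurable_xsection _ _ T1 T2 K w mX).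
- apply/mem_set.
  rewrite (_ : [set w0 | _] = (B (2 * pi) \- B cut) @^-1` [set B (2 * pi) w' - B cut w'])//.
  rewrite -[X in measurable X]setTI; apply: measurable_funB => //.
    by apply: (brownian_measurable BM); rewrite ltW// pi2_gt0.
  by apply: (brownian_measurable BM); rewrite -(fine_node_cut R 0) fine_node_ge0.
by move=> w''; rewrite /xsection /= inE => Kw''; exact: bridge_fibre Kw'' Kw'.
Qed.

End bridge.

(** * Continuous functions on the circle *)

Section circle_functions.
Variable R : realType.
Implicit Types (f : circle_fun R) (t : R).

Lemma circle_fun_cont_on f : cont_on (circle_val f).
Proof.
move=> t _ e e0; have /cvgrPdist_lt/(_ e%:C) := @circle_continuous _ f t.
rewrite ltcR => /(_ e0)/nbhs_ballP[dl /= dl0 h]; exists dl => // u _ ut.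
by rewrite -ltcR normcB; apply: h; rewrite -ball_normE /ball_/= distrC.
Qed.

Lemma nbhs_circle_fun f t (e : R) : 0 < e ->
  nbhs f [set g : circle_fun R | normc (circle_val f t - circle_val g t) < e].
Proof.
move=> e0.
have := @initial_continuous _ _ (@circle_val R : circle_fun R -> {uniform R -> R[i]}) f.
move=> /(_ [set g : {uniform R -> R[i]} | normc (circle_val f t - g t) < e]); apply.
apply/uniform_nbhs; exists [set xy : R[i] * R[i] | ball xy.1 e%:C xy.2]; split.
  by rewrite -entourage_ballE; exists e%:C => //=; rewrite ltcR.
move=> g /(_ t I) /=; rewrite -ball_normE /ball_/=.
by rewrite ltcR.
Qed.

(** Evaluation at a point is continuous for uniform convergence, hence Borel. The Lipschitz map [p]
    covers real and imaginary parts at once. *)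
Lemma measurable_circle_eval (p : R[i] -> R) t :
  (forall z w, `|p z - p w| <= normc (z - w)) ->
  measurable_fun setT (fun f : circle_fun_borel R => p (circle_val f t)).
Proof.
move=> hp; apply: (measurability _ (RGenOpens.measurableE R)).
move=> _ [_ [a [b ->] <-]]; rewrite setTI; apply: sub_sigma_algebra.
rewrite openE => f /= fab.
have : nbhs (p (circle_val f t)) `]a, b[%classic by exact: near_in_itvoo.
move=> /nbhs_ballP[e /= e0 h].
apply: filterS (nbhs_circle_fun f t e0) => g hg; apply: h.
by rewrite -ball_normE /ball_/= (le_lt_trans (hp _ _)).
Qed.

(** A loop is prescribed only on [0, 2pi], and this suffices to replace it by [bridge_path]. *)
Lemma level_ext N k (f g : R -> R[i]) :
  (forall t, 0 <= t <= 2 * pi -> f t = g t) -> level N k f = level N k g.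
Proof.
move=> fg; have E c n m e : badm c f n m e = badm c g n m e.
  apply/seteqP; split => t [ct [i im h]]; split => //; exists i => //;
    by move: h ct; rewrite /= in_itv/= => h /andP[t0 t1];
      rewrite ?fg -?fg// ?t0 ?ltW// in h *.
by rewrite /level; congr ex; apply/funext => q; under eq_forall do rewrite E.
Qed.

End circle_functions.

Section loop.
Context d (Omega : measurableType d) (R : realType) (P : probability Omega R).

Lemma loop_level_null (Z : R -> Omega -> R[i]) (X : Omega -> circle_fun R) N :
  (exists2 B, brownian_motion P B & Z = fun t w => (B t w)%:C)
    \/ complex_brownian_motion P Z ->
  loop_of Z X -> P [set w | forall k, level N k (circle_val (X w))] = 0%E.
Proof.
move=> hZ XZ; pose B t w := complex.Re (Z t w); pose V t w := complex.Im (Z t w).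
have -> : [set w | forall k, level N k (circle_val (X w))] =
    [set w | forall k, level N k (bridge_path B V (w, w))].
  have E w k : level N k (circle_val (X w)) = level N k (bridge_path B V (w, w)).
    apply: level_ext => t tpi; rewrite XZ// bridge_path_diag /B /V.
    by case: (Z t w) (Z (2 * pi) w) => a b [a' b']; rewrite mulcE oppcE addcE /=;
      congr Complex; ring.
  by apply/seteqP; split => w h k; have := h k; rewrite E.
case: hZ => [[B' BM ZE]|[BM VM indep]]; last first.
  by apply: bridge_null => //; [exact: (brownian_measurable VM)|exact: (brownian_continuous VM)].
have BB : B = B' by rewrite /B ZE.
have V0 : V = fun _ _ => 0 by rewrite /V ZE.
rewrite BB V0; apply: bridge_null => //.
  by move=> w; apply: continuous_subspaceT => t; exact: cvg_cst.
move=> n t t0 A A' mA mA'.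
(* In the real case V is identically 0, so its events are full or empty and independence is
   immediate. *)
have [A0|nA0] := pselect (forall i, (i < n)%N -> A' i 0).
  have -> : \bigcap_(i < n) [set _ : Omega | A' i 0] = setT.
    by apply/seteqP; split => // w _ i; exact: A0.
  by rewrite setIT probability_setT mule1.
have -> : \bigcap_(i < n) [set _ : Omega | A' i 0] = set0.
  by rewrite -subset0 => w h; apply: nA0 => i; exact: h.
by rewrite setI0 measure0 mule0.
Qed.

End loop.

Theorem theorem4 (R : realType) (W : probability (circle_fun_borel R) R)
    (W_wiener : wiener_measure W) :
  W.-negligible [set f : circle_fun_borel R | PLA (circle_val f)].
Proof.
case: W_wiener => d [] Omega [] P [] Z [] X [hZ XZ mX WE].
have mRe l i : (i < 2 ^ l)%N -> measurable_fun setT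
    (fun f : circle_fun_borel R => complex.Re (circle_val f (node R (2 ^ l) i))).
  move=> _; apply: measurable_circle_eval => z w; case: z w => a b [a' b'].
  exact: (normc_Re ((a +i* b) - (a' +i* b'))).
have mIm l i : (i < 2 ^ l)%N -> measurable_fun setT
    (fun f : circle_fun_borel R => complex.Im (circle_val f (node R (2 ^ l) i))).
  move=> _; apply: measurable_circle_eval => z w; case: z w => a b [a' b'].
  exact: (normc_Im ((a +i* b) - (a' +i* b'))).
have cont (f : circle_fun_borel R) : cont_on (circle_val f) by exact: circle_fun_cont_on.
(* These sets are Borel, so their [W]-measure can be computed on the probability space that carries
   the Brownian motion. *)
have null N : W [set f : circle_fun_borel R | forall k, level N k (circle_val f)] = 0%E.
  rewrite WE; first exact: loop_level_null hZ XZ.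
  exact: (measurable_all_levels cont mRe mIm).
exact: (negligible_represented cont mRe mIm null).
Qed.
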